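(* For every finite simple graph $G$, the following statements are equivalent: (i) $G$ is a $2$-probe block graph; (ii) $G$ is distance-hereditary and $\{B_1,\dots,B_6,G_1,\dots,G_{16}\}$-free; (iii) $G$ is $\{G_1,\dots,G_{16}\}$-free and every block of $G$ is a $2$-probe complete graph.
   Context: Graphs are finite and simple. A block of a graph is a maximal connected subgraph without a cut-vertex; a block graph is a graph all of whose blocks are cliques. A graph $G=(V,E)$ is a $2$-probe block graph (resp. $2$-probe complete graph) if there exist independent sets $N_1,N_2\subseteq V$ (possibly empty) and a block graph (resp. complete graph) $G'=(V,E')$ with $E\subseteq E'$ such that every edge $xy\in E'\setminus E$ has $x,y\in N_1$ or $x,y\in N_2$. A graph is distance-hereditary if every induced path between two vertices is a shortest path. A graph is $\mathcal{F}$-free if no induced subgraph is isomorphic to a member of $\mathcal{F}$. $G+H$ is disjoint union, $2H=H+H$, and the join $G\star H$ is $G+H$ plus all edges between $G$ and $H$. Auxiliary graphs: a diamond $D$ is $K_4$ minus an edge (its two nonadjacent vertices have degree $2$, the others degree $3$); $C_4$ is the $4$-cycle; $W_4=K_1\star C_4$ (the $K_1$ vertex is the hub); $F_1=K_2\star(K_2+K_1)$ (its two vertices of the $K_2$ factor have degree $4$, the vertex of the $K_1$ has degree $2$, the other two have degree $3$). ''Identifying'' vertices means gluing two vertex-disjoint graphs at one vertex. The graphs $B_i$ (vertex sets $\{1,\dots,6\}$ except $B_1$): $B_1=(K_2+K_1)\star 2K_1$; $B_2$ has edges $12,23,34,45,56,61,14,36$; $B_3=2K_1\star 2K_1\star 2K_1$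 (the octahedron); $B_4$ has edges $12,23,34,45,56,61,13,14,36,46$; $B_5=2K_2\star K_2$; $B_6=(K_3+K_1)\star K_2$. The graphs $G_j$: $G_1$: a diamond and a copy of $F_1$ with a degree-2 vertex of the diamond identified with a degree-4 vertex of $F_1$. $G_2$: a $C_4$ with one of its vertices identified with a degree-4 vertex of $F_1$. $G_3$: a diamond with a degree-2 vertex identified with the hub of $W_4$. $G_4$: a $C_4$ with one vertex identified with the hub of $W_4$. $G_5$: $F_1$ with its degree-2 vertex identified with a degree-3 vertex of a diamond. $G_6$: $F_1$ with its degree-2 vertex identified with a vertex of a $C_4$. $G_7$: two copies of $F_1$, the degree-2 vertex of the first identified with a degree-3 vertex of the second. $G_8$: a copy of $F_1$ and a disjoint diamond, plus one edge joining the degree-2 vertex of $F_1$ to a degree-2 vertex of the diamond. $G_9$: a copy of $F_1$ and a disjoint $C_4$, plus one edge joining the degree-2 vertex of $F_1$ to a vertex of the $C_4$. $G_{10}$: three diamonds $H_1,M,H_3$, where the two degree-3 vertices of $M$ are identified one with a degree-2 vertex of $H_1$ and the other with a degree-2 vertex of $H_3$ ($H_1,H_3$ otherwise disjoint). $G_{11}$: as $G_{10}$ but $H_1$ is a $C_4$ (the identified vertex being any vertex of it). $G_{12}$: as $G_{10}$ but both $H_1$ and $H_3$ are $C_4$'s. $G_{13}$: a triangle $abc$ and three otherwise disjoint diamonds, each of $a,b,c$ identified with a degree-2 vertex of its own diamond. $G_{14},G_{15},G_{16}$: as $G_{13}$ but with exactly one, exactly two, respectively all three of the diamonds replaced by $C_4$'s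 (identified at any vertex). *)

(* Defs.v *)
From Stdlib Require List.
From mathcomp Require Import all_boot.

Set Implicit Arguments.
Unset Strict Implicit.
Unset Printing Implicit Defensive.

Record sgraph := SGraph {
  vert :> finType;
  adj : rel vert;
  adj_sym : symmetric adj;
  adj_irr : irreflexive adj }.

Notation "x -- y" := (adj x y) (at level 30, no associativity).

Definition isomorphic (G H : sgraph) : Prop :=
  exists2 f : G -> H, bijective f & forall x y, f x -- f y = x -- y.

(* Not necessarily induced. *)
Record subgraph (G : sgraph) := Subgraph {
  sub_vert : {set G};
  sub_adj : rel G;
  sub_adj_sym : symmetric sub_adj;
  sub_adj_sub : forall x y, sub_adj x y ->
    [/\ x \in sub_vert, y \in sub_vert & x -- y] }.

Section SubgraphGraph.
Variables (G : sgraph) (S : subgraph G).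

Definition subg_adj : rel {x : G | x \in sub_vert S} :=
  [rel x y | sub_adj S (val x) (val y)].

Lemma subg_adj_sym : symmetric subg_adj.
Proof. by move=> x y; apply: sub_adj_sym. Qed.

Lemma subg_adj_irr : irreflexive subg_adj.
Proof.
move=> x; apply/negP => /= /sub_adj_sub [_ _]; by rewrite adj_irr.
Qed.

Definition graph_of_subgraph := SGraph subg_adj_sym subg_adj_irr.
End SubgraphGraph.

Coercion graph_of_subgraph : subgraph >-> sgraph.

Definition subgraph_le (G : sgraph) (S S' : subgraph G) : Prop :=
  sub_vert S \subset sub_vert S' /\ subrel (sub_adj S) (sub_adj S').

Section Induced.
Variables (G : sgraph) (A : {set G}).

Definition ind_adj : rel G := [rel x y | [&& x \in A, y \in A & x -- y]].

Lemma ind_adj_sym : symmetric ind_adj.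
Proof. by move=> x y; rewrite /ind_adj /= adj_sym andbCA. Qed.

Lemma ind_adj_sub x y : ind_adj x y -> [/\ x \in A, y \in A & x -- y].
Proof. by move/and3P. Qed.

Definition induced : subgraph G := Subgraph ind_adj_sym ind_adj_sub.
End Induced.

Definition free (F : seq sgraph) (G : sgraph) : Prop :=
  forall (H : sgraph) (A : {set G}), List.In H F -> ~ isomorphic (induced A) H.

Definition connected (G : sgraph) : Prop :=
  0 < #|G| /\ forall x y : G, connect (@adj G) x y.

(* v separates two vertices of the same component. *)
Definition cut_vertex (G : sgraph) (v : G) : Prop :=
  exists x y : induced [set~ v],
    connect (@adj G) (val x) (val y) /\
    ~~ connect (@adj (induced [set~ v])) x y.

Definition connected_without_cut_vertex (G : sgraph) : Prop :=
  connected G /\ forall v : G, ~ cut_vertex v.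

Definition block (G : sgraph) (B : subgraph G) : Prop :=
  connected_without_cut_vertex B /\
  forall B' : subgraph G, connected_without_cut_vertex B' ->
    subgraph_le B B' -> subgraph_le B' B.

Definition complete (G : sgraph) : Prop := forall x y : G, x != y -> x -- y.

Definition block_graph (G : sgraph) : Prop :=
  forall B : subgraph G, block B -> complete B.

Definition independent (G : sgraph) (N : {set G}) : Prop :=
  forall x y, x \in N -> y \in N -> ~~ x -- y.

Definition two_probe (P : sgraph -> Prop) (G : sgraph) : Prop :=
  exists (N1 N2 : {set G}) (E' : rel G)
         (symE' : symmetric E') (irrE' : irreflexive E'),
    [/\ independent N1, independent N2, P (SGraph symE' irrE'),
        subrel (@adj G) E' &
        forall x y, E' x y -> ~~ x -- y ->
          (x \in N1 /\ y \in N1) \/ (x \in N2 /\ y \in N2)].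

Definition two_probe_block_graph := two_probe block_graph.
Definition two_probe_complete_graph := two_probe complete.

(* In these definitions x :: p is the list of vertices of a path. *)
Definition is_path (G : sgraph) (x y : G) (p : seq G) : bool :=
  [&& path (@adj G) x p, uniq (x :: p) & last x p == y].

Definition induced_path (G : sgraph) (x y : G) (p : seq G) : Prop :=
  is_path x y p /\
  forall i j, i < j <= size p ->
    nth x (x :: p) i -- nth x (x :: p) j -> j = i.+1.

Definition shortest_path (G : sgraph) (x y : G) (p : seq G) : Prop :=
  is_path x y p /\ forall q, is_path x y q -> size p <= size q.

Definition distance_hereditary (G : sgraph) : Prop :=
  forall (x y : G) (p : seq G), induced_path x y p -> shortest_path x y p.

Section Constructions.

Lemma neq_sym (T : eqType) : symmetric (fun x y : T => x != y).
Proof. by move=> x y; rewrite eq_sym. Qed.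

Lemma neq_irr (T : eqType) : irreflexive (fun x y : T => x != y).
Proof. by move=> x; rewrite eqxx. Qed.

Definition K (n : nat) : sgraph := SGraph (@neq_sym 'I_n) (@neq_irr 'I_n).

(* Vertices are labelled 1, ..., n: the vertex i : 'I_n has label i.+1. *)
Definition edges_adj n (E : seq (nat * nat)) : rel 'I_n :=
  [rel i j : 'I_n | (i != j) && (((i.+1, j.+1) \in E) || ((j.+1, i.+1) \in E))].

Lemma edges_adj_sym n E : symmetric (@edges_adj n E).
Proof. by move=> i j; rewrite /edges_adj /= eq_sym orbC. Qed.

Lemma edges_adj_irr n E : irreflexive (@edges_adj n E).
Proof. by move=> i; rewrite /edges_adj /= eqxx. Qed.

Definition graph_of_edges n E : sgraph :=
  SGraph (@edges_adj_sym n E) (@edges_adj_irr n E).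

Variables G H : sgraph.

Definition dunion_adj : rel (G + H) := fun a b =>
  match a, b with
  | inl x, inl y => x -- y
  | inr x, inr y => x -- y
  | _, _ => false
  end.

Lemma dunion_adj_sym : symmetric dunion_adj.
Proof. by case=> x [] y //=; apply: adj_sym. Qed.

Lemma dunion_adj_irr : irreflexive dunion_adj.
Proof. by case=> x /=; apply: adj_irr. Qed.

Definition dunion : sgraph := SGraph dunion_adj_sym dunion_adj_irr.

Definition join_adj : rel (G + H) := fun a b =>
  match a, b with
  | inl x, inl y => x -- y
  | inr x, inr y => x -- y
  | _, _ => true
  end.

Lemma join_adj_sym : symmetric join_adj.
Proof. by case=> x [] y //=; apply: adj_sym. Qed.

Lemma join_adj_irr : irreflexive join_adj.
Proof. by case=> x /=; apply: adj_irr. Qed.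

Definition join : sgraph := SGraph join_adj_sym join_adj_irr.

(* G and H with u and v identified; the common vertex is inl u. *)
Section Glue.
Variables (u : G) (v : H).

Definition glue_adj : rel (G + {y : H | y != v}) := fun a b =>
  match a, b with
  | inl x, inl y => x -- y
  | inr x, inr y => val x -- val y
  | inl x, inr y => (x == u) && v -- val y
  | inr x, inl y => (y == u) && v -- val x
  end.

Lemma glue_adj_sym : symmetric glue_adj.
Proof. by case=> x [] y //=; apply: adj_sym. Qed.

Lemma glue_adj_irr : irreflexive glue_adj.
Proof. by case=> x /=; apply: adj_irr. Qed.

Definition glue : sgraph := SGraph glue_adj_sym glue_adj_irr.
End Glue.

(* G and H disjoint, together with one edge between u and v. *)
Section Link.
Variables (u : G) (v : H).

Definition link_adj : rel (G + H) := fun a b =>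
  match a, b with
  | inl x, inl y => x -- y
  | inr x, inr y => x -- y
  | inl x, inr y => (x == u) && (y == v)
  | inr x, inl y => (y == u) && (x == v)
  end.

Lemma link_adj_sym : symmetric link_adj.
Proof. by case=> x [] y //=; apply: adj_sym. Qed.

Lemma link_adj_irr : irreflexive link_adj.
Proof. by case=> x /=; apply: adj_irr. Qed.

Definition link : sgraph := SGraph link_adj_sym link_adj_irr.
End Link.

End Constructions.

Definition double (H : sgraph) := dunion H H.

Definition C4 := graph_of_edges 4 [:: (1,2); (2,3); (3,4); (4,1)].
Definition C4_v : C4 := (ord0 : 'I_4).

(* K_4 minus the edge between the two vertices of double (K 1). *)
Definition diamond := join (K 2) (double (K 1)).
Definition diamond_deg3 : diamond := inl (ord0 : 'I_2).
Definition diamond_deg3' : diamond := inl (ord_max : 'I_2).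
Definition diamond_deg2 : diamond := inr (inl (ord0 : 'I_1)).

Definition W4 := join (K 1) C4.
Definition W4_hub : W4 := inl (ord0 : 'I_1).

Definition F1 := join (K 2) (dunion (K 2) (K 1)).
Definition F1_deg4 : F1 := inl (ord0 : 'I_2).
Definition F1_deg3 : F1 := inr (inl (ord0 : 'I_2)).
Definition F1_deg2 : F1 := inr (inr (ord0 : 'I_1)).

Definition B1 := join (dunion (K 2) (K 1)) (double (K 1)).
Definition B2 := graph_of_edges 6
  [:: (1,2); (2,3); (3,4); (4,5); (5,6); (6,1); (1,4); (3,6)].
Definition B3 := join (join (double (K 1)) (double (K 1))) (double (K 1)).
Definition B4 := graph_of_edges 6
  [:: (1,2); (2,3); (3,4); (4,5); (5,6); (6,1); (1,3); (1,4); (3,6); (4,6)].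
Definition B5 := join (double (K 2)) (K 2).
Definition B6 := join (dunion (K 3) (K 1)) (K 2).

(* H and H' glued at the two degree-3 vertices of a middle diamond. *)
Definition diamond_chain (H : sgraph) (v : H) (H' : sgraph) (v' : H') :=
  glue (inl diamond_deg3' : glue diamond_deg3 v) v'.

Definition K3_a : K 3 := (@Ordinal 3 0 isT).
Definition K3_b : K 3 := (@Ordinal 3 1 isT).
Definition K3_c : K 3 := (@Ordinal 3 2 isT).

Definition triangle_glue (H : sgraph) (v : H) (H' : sgraph) (v' : H')
    (H'' : sgraph) (v'' : H'') :=
  glue (inl (inl K3_c) : glue (inl K3_b : glue K3_a v) v') v''.

Definition G1 := glue diamond_deg2 F1_deg4.
Definition G2 := glue C4_v F1_deg4.
Definition G3 := glue diamond_deg2 W4_hub.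
Definition G4 := glue C4_v W4_hub.
Definition G5 := glue F1_deg2 diamond_deg3.
Definition G6 := glue F1_deg2 C4_v.
Definition G7 := glue F1_deg2 F1_deg3.
Definition G8 := link F1_deg2 diamond_deg2.
Definition G9 := link F1_deg2 C4_v.
Definition G10 := diamond_chain diamond_deg2 diamond_deg2.
Definition G11 := diamond_chain C4_v diamond_deg2.
Definition G12 := diamond_chain C4_v C4_v.
Definition G13 := triangle_glue diamond_deg2 diamond_deg2 diamond_deg2.
Definition G14 := triangle_glue C4_v diamond_deg2 diamond_deg2.
Definition G15 := triangle_glue C4_v C4_v diamond_deg2.
Definition G16 := triangle_glue C4_v C4_v C4_v.

Definition B_list : seq sgraph := [:: B1; B2; B3; B4; B5; B6].
Definition G_list : seq sgraph :=
  [:: G1; G2; G3; G4; G5; G6; G7; G8; G9; G10; G11; G12; G13; G14; G15; G16].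

(* Main.v *)
Require Import Defs.
From mathcomp Require Import all_boot.

(* Call two vertices inseparable if they lie in a common block, and call an
   inseparable nonadjacent pair a nonedge. Completing every block of G gives its
   smallest block supergraph, so G is a 2-probe block graph iff it has a probe
   labelling: independent sets N1, N2 such that both ends of every nonedge lie in
   N1 or both lie in N2. Locally, this is possible iff in every block the graph of
   nonedges is covered by two cliques, that is, has no induced P_4, C_4, K_{1,3},
   P_3 + K_2 or 3 K_2; each of the graphs B_i contains one of these five, and in a
   distance-hereditary graph each of the five extends to one of the B_i.

   Globally, a vertex with a nonedge must be labelled, and one with two nonedges to
   adjacent vertices (the degree-2 vertex of an F_1) must get both labels. Adjacent
   labelled vertices must get opposite labels. The graphs G_1, ..., G_16 are the ways
   in which these demands conflict along one edge or inside one block. Without them, every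
   block has a 2-colouring compatible with the demands on its vertices, and these
   colourings, up to a swap of the colours in each block, glue along the block tree to
   a 2-colouring of G. *)

(** The three statements meet in [probe_blocks]: each of them implies it, and together with freeness
    of the graphs G_j it yields a labelling.

    Once P_4 is excluded among the nonedges, induced paths between inseparable vertices have length
    at most 2. So the ends of a nonedge have two common neighbours, and form the nonadjacent pair of
    a diamond or opposite vertices of a C_4. This is why most G_j come in families whose members
    differ only by exchanging these two graphs.

    A copy of G_j must be induced, while its pieces are found independently of each other.
    Separation supplies what is missing: if one vertex of G separates two pieces glued at it, they
    can neither overlap elsewhere nor have further edges between them. Hence the work is done with
    inseparability and with paths avoiding a vertex, not with blocks as maximal subgraphs. *)

Set Implicit Arguments.
Unset Strict Implicit.
Unset Printing Implicit Defensive.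

(** * Inseparable vertices and blocks *)

Section Inseparable.
Variable G : sgraph.
Implicit Types (x y z t u v : G) (p : seq G).

Definition avoid t : rel G := [rel x y | [&& x != t, y != t & x -- y]].
Definition linked t : rel G := connect (avoid t).

(* By Menger's theorem, this says that x and y lie in a common block. *)
Definition insep : rel G := [rel x y | [&& x != y, connect (@adj G) x y &
  [forall t, (t != x) ==> (t != y) ==> linked t x y]]].

Lemma adj_neq x y : x -- y -> x != y.
Proof. by apply: contraTneq => ->; rewrite adj_irr. Qed.

Lemma avoid_sym t : symmetric (avoid t).
Proof. by move=> x y; rewrite /avoid /= adj_sym andbCA. Qed.

Lemma linkedC t x y : linked t x y = linked t y x.
Proof. exact/sym_connect_sym/avoid_sym. Qed.

Lemma connectC x y : connect (@adj G) x y = connect (@adj G) y x.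
Proof. exact/sym_connect_sym/adj_sym. Qed.

Lemma linked_trans t y x z : linked t x y -> linked t y z -> linked t x z.
Proof. exact: connect_trans. Qed.

Lemma linked_connect t x y : linked t x y -> connect (@adj G) x y.
Proof. by apply: connect_sub => u v /and3P[_ _ ?]; apply: connect1. Qed.

Lemma linked_neq t x y : linked t x y -> x != t -> y != t.
Proof.
case/connectP=> p; elim: p x => [|z p IH] x /=; first by move=> _ ->.
by case/andP=> /and3P[_ zt _] pz E _; apply: IH E zt.
Qed.

Lemma linked_adj t x y : x -- y -> x != t -> y != t -> linked t x y.
Proof. by move=> xy xt yt; apply: connect1; rewrite /avoid /= xt yt. Qed.

Lemma linked_path t x p : path (@adj G) x p -> t \notin x :: p ->
  linked t x (last x p).
Proof.
elim: p x => [|z p IH] x; first by rewrite /linked connect0.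
rewrite /= inE negb_or => /andP[xz pz] /andP[tx tzp].
apply: linked_trans (IH z pz tzp); move: tzp; rewrite inE negb_or => /andP[tz _].
by rewrite linked_adj // eq_sym.
Qed.

Lemma insepP x y : reflect [/\ x != y, connect (@adj G) x y &
  forall t, t != x -> t != y -> linked t x y] (insep x y).
Proof.
apply: (iffP and3P) => [] [xy cxy H]; split=> //.
  by move=> t tx ty; move/forallP/(_ t): H; rewrite tx ty.
by apply/forallP=> t; apply/implyP=> tx; apply/implyP=> ty; apply: H.
Qed.

Lemma insep_neq x y : insep x y -> x != y.
Proof. by case/insepP. Qed.

Lemma insep_connect x y : insep x y -> connect (@adj G) x y.
Proof. by case/insepP. Qed.

Lemma insep_linked t x y : insep x y -> x != t -> y != t -> linked t x y.
Proof. by case/insepP=> _ _ H; rewrite -!(eq_sym t); apply: H. Qed.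

Lemma insepC x y : insep x y = insep y x.
Proof.
by rewrite /insep /= eq_sym connectC; congr [&& _, _ & _]; apply: eq_forallb => t;
  rewrite linkedC; do 2!case: (t != _).
Qed.

Lemma insep_irr x : insep x x = false.
Proof. by rewrite /insep /= eqxx. Qed.

Lemma adj_insep x y : x -- y -> insep x y.
Proof.
move=> xy; apply/insepP; split; [exact: adj_neq | exact: connect1 |].
by move=> t tx ty; rewrite linked_adj // eq_sym.
Qed.

(** A vertex other than [y] is avoided by passing through [y], so [y] is the only possible
    separator. *)
Lemma linked_insep y x z : insep y x -> insep y z -> linked y x z -> x != z ->
  insep x z.
Proof.
move=> yx yz xyz xz; apply/insepP; split=> //; first exact: linked_connect xyz.
move=> t tx tz; have [->//|ty] := eqVneq t y.
by apply: (linked_trans (y := y)); apply: insep_linked; rewrite // 1?insepC // eq_sym.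
Qed.

(** A deleted vertex spares [x] or [y], and [z] reaches [u] through the one that is left. This
    replaces transitivity, which fails at cut vertices. *)
Lemma insep_trans2 x y z u : insep x y ->
  insep z x -> insep z y -> insep u x -> insep u y -> z != u -> insep z u.
Proof.
move=> xy zx zy ux uy zu; apply/insepP; split=> //.
  by apply: (connect_trans (y := x)); apply: insep_connect; rewrite // insepC.
move=> t; rewrite ![t == _]eq_sym => tz tu; have [xt|xt] := eqVneq x t.
  have yt : y != t by rewrite -xt eq_sym insep_neq.
  by apply: (linked_trans (y := y)); apply: insep_linked; rewrite // insepC.
by apply: (linked_trans (y := x)); apply: insep_linked; rewrite // insepC.
Qed.

(* The vertex set of the block containing the inseparable pair x, y. *)
Definition blk x y : {set G} :=
  [set z | ((z == x) || insep z x) && ((z == y) || insep z y)].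

Lemma blk_l x y : insep x y -> x \in blk x y.
Proof. by move=> xy; rewrite inE eqxx xy orbT. Qed.

Lemma blk_r x y : insep x y -> y \in blk x y.
Proof. by rewrite insepC => xy; rewrite inE eqxx xy orbT. Qed.

Lemma blk_insep x y u v : insep x y ->
  u \in blk x y -> v \in blk x y -> u != v -> insep u v.
Proof.
move=> xy; rewrite !inE => /andP[ux uy] /andP[vx vy] uv.
have [ex|nx] := eqVneq u x.
  by subst u; move: vx; rewrite eq_sym (negPf uv) insepC.
have [ey|ny] := eqVneq u y.
  by subst u; move: vy; rewrite eq_sym (negPf uv) insepC.
move: ux uy; rewrite (negPf nx) (negPf ny) /= => ux uy.
have [ex|mx] := eqVneq v x; first by rewrite ex.
have [ey|my] := eqVneq v y; first by rewrite ey.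
move: vx vy; rewrite (negPf mx) (negPf my) /= => vx vy.
exact: (insep_trans2 xy).
Qed.

Lemma blk_max x y u v w : insep x y -> u \in blk x y -> v \in blk x y ->
  u != v -> insep w u -> insep w v -> w \in blk x y.
Proof.
move=> xy ub vb uv wu wv.
have H z : z \in blk x y -> (w == z) || insep w z.
  move=> zb; have [->//|wz] /= := eqVneq w z.
  have [<-//|uz] := eqVneq u z; have [<-//|vz] := eqVneq v z.
  apply: (insep_trans2 (blk_insep xy ub vb uv)) => //;
    by apply: (blk_insep xy); rewrite // eq_sym.
by rewrite inE !H // ?blk_l ?blk_r.
Qed.

Lemma blk_eq x y u v : insep x y -> u \in blk x y -> v \in blk x y ->
  u != v -> blk u v = blk x y.
Proof.
move=> xy ub vb uv; have uvI := blk_insep xy ub vb uv.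
apply/setP=> z; apply/idP/idP => zb.
  have [->//|zu] := eqVneq z u; have [->//|zv] := eqVneq z v.
  apply: (blk_max xy ub vb uv); apply: (blk_insep uvI) => //.
  - exact: blk_l.
  - exact: blk_r.
have H w : w \in blk x y -> (z == w) || insep z w.
  by move=> wb; case: eqVneq => //= zw; apply: (blk_insep xy).
by rewrite inE !H.
Qed.

(** A path between two vertices of a block stays in the block: the deleted vertex [t] occurs at most
    once on it, so every other vertex of the path still reaches [x] or [y] along the path, and these
    two are linked if neither is [t]. *)
Lemma path_insep x y p u v : insep x y -> path (@adj G) x p -> last x p = y ->
  uniq (x :: p) -> u \in x :: p -> v \in x :: p -> u != v -> insep u v.
Proof.
move=> xy pp ly up uP vP uv.
have H t w : w \in x :: p -> w != t ->
    (x != t) && linked t w x || (y != t) && linked t w y.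
  move=> wP wt; case/splitPl: wP pp ly up => p1 p2 lp1.
  rewrite cat_path last_cat lp1 => /andP[pp1 pp2] ly up.
  have [tp1|tp1] := boolP (t \in x :: p1); last first.
    apply/orP; left; apply/andP; split.
      by apply: contraNneq tp1 => ->; rewrite inE eqxx.
    by rewrite linkedC -lp1; apply: linked_path.
  have tp2 : t \notin w :: p2.
    rewrite inE negb_or eq_sym wt /=; apply/negP=> tp2.
    move: up; rewrite -cat_cons cat_uniq => /and3P[_ /hasPn/(_ _ tp2) /=].
    by rewrite tp1.
  apply/orP; right; apply/andP; split.
    apply: contraNneq tp2 => <-; rewrite -ly; exact: mem_last.
  by rewrite -ly; apply: linked_path.
have wx w : w \in x :: p -> connect (@adj G) x w.
  move=> wP; case/splitPl: wP pp => p1 p2 lp1.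
  rewrite cat_path => /andP[pp1 _]; apply/connectP; by exists p1.
apply/insepP; split=> //.
  by apply: connect_trans (wx v vP); rewrite connectC wx.
move=> t tu tv; rewrite eq_sym in tu; rewrite eq_sym in tv.
have := H t u uP tu; have := H t v vP tv.
move=> /orP[]/andP[a1 a2] /orP[]/andP[b1 b2].
- by apply: linked_trans b2 _; rewrite linkedC.
- apply: linked_trans b2 _; rewrite linkedC; apply: linked_trans a2 _.
  exact: insep_linked.
- apply: linked_trans b2 _; rewrite linkedC; apply: linked_trans a2 _.
  by apply: insep_linked; rewrite // insepC.
- by apply: linked_trans b2 _; rewrite linkedC.
Qed.

(** A shortest walk among those avoiding [t] has no chord. Tuples make its length a boolean
    existence statement, so that a least one can be taken. *)
Lemma linked_induced_path t x y : linked t x y -> x != t ->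
  exists p, induced_path x y p /\ t \notin x :: p.
Proof.
move=> xy xt.
have ex : exists n, [exists p : n.-tuple G, path (avoid t) x p && (last x p == y)].
  case/connectP: xy => p pp ->; exists (size p); apply/existsP.
  by exists (in_tuple p); rewrite pp eqxx.
case: (ex_minnP ex) => n /existsP[p0 /andP[pp0 /eqP lp0]] Hmin.
have sp : size p0 = n by rewrite size_tuple.
move: (tval p0) pp0 lp0 sp => p pp lp sp {p0}.
have Hm q : path (avoid t) x q -> last x q = y -> n <= size q.
  move=> pq lq; apply: Hmin; apply/existsP; exists (in_tuple q).
  by rewrite pq lq eqxx.
have tp : t \notin x :: p.
  elim: (p) (x) xt pp {lp sp Hm} => [|z q IH] w wt /=; first by rewrite inE eq_sym.
  by case/andP=> /and3P[_ zt _] pq; rewrite inE negb_or eq_sym wt IH.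
have ap : path (@adj G) x p by apply: sub_path pp => u v /and3P[].
have up : uniq (x :: p).
  case: (shortenP pp) lp => q pq uq qp lq.
  have := Hm q pq lq; rewrite -sp => spq; have /andP[xq uq'] := uq.
  have [_ Ep] := uniq_min_size uq' qp spq.
  by rewrite /= -(Ep x) xq (leq_size_uniq uq' qp spq).
exists p; split=> //; split; first by rewrite /is_path ap up lp eqxx.
move=> i j /andP[ij jp] aij; apply/eqP; rewrite eqn_leq ij andbT leqNgt.
apply/negP=> lij; case: j => [//|j] in ij jp aij lij *.
have ip : i <= size p by apply: leq_trans jp; apply: ltnW.
(* The shortcut along the chord. Positions [i] and [j.+1] count in [x :: p], so the latter vertex is
   entry [j] of [p]. *)
pose q := take i p ++ nth x p j :: drop j.+1 p.
have li : last x (take i p) = nth x (x :: p) i.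
  case: i ip {ij aij lij q} => [|i] ip; first by rewrite take0.
  by rewrite /= (take_nth x) // last_rcons.
have Ed : drop j p = nth x p j :: drop j.+1 p by apply: drop_nth.
have := pp; rewrite -{1}(cat_take_drop j p) cat_path Ed /= => /andP[_ /andP[_ pd]].
have := pp; rewrite -{1}(cat_take_drop i p) cat_path => /andP[pt _].
have nt k : k <= size p -> nth x (x :: p) k != t.
  by move=> kp; apply: contraNneq tp => <-; apply: mem_nth.
have := Hm q; rewrite /q cat_path pt /= pd li /avoid /= aij andbT.
rewrite nt // (nt j.+1) //= => /(_ isT).
have lq : last x (take i p ++ nth x p j :: drop j.+1 p) = y.
  by rewrite last_cat -[RHS]lp -[in RHS](cat_take_drop j p) last_cat Ed.
move=> /(_ lq); rewrite size_cat /= size_takel // size_drop -sp leqNgt => /negP; apply.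
by rewrite subnSK // -{2}(subnKC (ltnW jp)) ltn_add2r.
Qed.

End Inseparable.

Lemma connect_homo (T T' : finType) (e : rel T) (e' : rel T') (f : T -> T') :
  (forall x y, e x y -> connect e' (f x) (f y)) ->
  forall x y, connect e x y -> connect e' (f x) (f y).
Proof.
move=> H x y /connectP[p]; elim: p x => [|z p IH] x /=; first by move=> _ ->.
by case/andP=> xz pz E; apply: connect_trans (H _ _ xz) (IH _ pz E).
Qed.

Lemma linked_homo (G H : sgraph) (f : G -> H) s t :
  (forall x y, x -- y -> f x -- f y) -> (forall x, x != s -> f x != t) ->
  forall x y, linked s x y -> linked t (f x) (f y).
Proof.
move=> fE fs; apply: connect_homo => x y /and3P[xs ys xy].
by apply: linked_adj; rewrite ?fs ?fE.
Qed.

Lemma connect_linked (G H : sgraph) (f : G -> H) t :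
  (forall x y, x -- y -> f x -- f y) -> (forall x, f x != t) ->
  forall x y, connect (@adj G) x y -> linked t (f x) (f y).
Proof.
by move=> fE ft; apply: connect_homo => x y xy; apply: linked_adj; rewrite ?ft ?fE.
Qed.

Lemma insep_homo (G H : sgraph) (f : G -> H) : injective f ->
  (forall x y, x -- y -> f x -- f y) ->
  forall x y, insep x y -> insep (f x) (f y).
Proof.
move=> fI fE x y /insepP[xy cxy lxy]; apply/insepP; split.
- by rewrite (inj_eq fI).
- by apply: connect_homo cxy => u v uv; apply/connect1/fE.
move=> t tx ty; have [s /eqP Es|ns] := pickP (fun s => f s == t).
  apply: (linked_homo (s := s)) => //; last first.
    by apply: lxy; [apply: contraNneq tx|apply: contraNneq ty] => <-; rewrite Es.
  by move=> u us; rewrite -Es (inj_eq fI).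
by apply: connect_linked => // u; rewrite ns.
Qed.

Lemma connect_subgraph (G : sgraph) (S : subgraph G) (x y : S) :
  connect (@adj S) x y = connect (sub_adj S) (val x) (val y).
Proof.
apply/idP/idP; first by apply: connect_homo => u v uv; apply: connect1.
case/connectP=> p; elim: p x => [|z p IH] x /=.
  by move=> _ /val_inj->.
case/andP=> xz pz E; have [_ zS _] := sub_adj_sub xz.
by apply: (connect_trans (y := Sub z zS)); [exact: connect1 | exact: IH].
Qed.

Lemma connected_without_cut_vertexP (G : sgraph) :
  connected_without_cut_vertex G <->
  0 < #|G| /\ forall x y : G, x != y -> insep x y.
Proof.
split=> [[[G0 cG] ncut]|[G0 GI]].
  split=> // x y xy; apply/insepP; split=> // t tx ty; apply/negPn/negP=> nl.
  have xt : x \in [set~ t] by rewrite !inE eq_sym.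
  have yt : y \in [set~ t] by rewrite !inE eq_sym.
  case: (ncut t); exists (Sub x xt), (Sub y yt); split; first exact: cG.
  rewrite connect_subgraph /=; apply: contra nl.
  by apply: connect_sub => u v /and3P[]; rewrite !inE => *; apply: linked_adj.
split; first split=> // x y.
  by have [->//|/GI/insep_connect] := eqVneq x y.
move=> t [x [y [_]]]; rewrite connect_subgraph => /negP; apply.
have [->//|/GI xy] := eqVneq (val x) (val y).
have := valP x; have := valP y; rewrite !inE => yt xt.
apply: connect_sub (insep_linked xy xt yt) => u v /and3P[ut vt uv].
by apply: connect1; rewrite /= /ind_adj /= !inE ut vt.
Qed.

(** * Blocks as the vertex sets of pairwise inseparable vertices *)

Section Blocks.
Variable G : sgraph.
Implicit Types x y : G.

Lemma subgraph_insep (B : subgraph G) (x y : B) : insep x y ->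
  insep (val x) (val y).
Proof.
apply: insep_homo; first exact: val_inj.
by move=> u v /sub_adj_sub[].
Qed.

Lemma block_insep (B : subgraph G) x y : connected_without_cut_vertex B ->
  x \in sub_vert B -> y \in sub_vert B -> x != y -> insep x y.
Proof.
case/connected_without_cut_vertexP=> _ H xB yB xy.
exact: (@subgraph_insep _ (Sub x xB) (Sub y yB)) (H _ _ _).
Qed.

Lemma lift_path (D : {set G}) (x : induced D) p :
  path (@adj G) (val x) p -> {subset p <= D} ->
  exists2 q : seq (induced D), p = map val q & path (@adj (induced D)) x q.
Proof.
elim: p x => [|z p IH] x /=; first by exists [::].
case/andP=> xz pz pD; have zD : z \in D by apply: pD; rewrite inE eqxx.
have [|q Eq pq] := IH (Sub z zD) pz.
  by move=> w wp; apply: pD; rewrite inE wp orbT.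
exists (Sub z zD :: q); first by rewrite /= Eq.
by rewrite /= pq andbT /subg_adj /= /ind_adj /= (valP x) zD.
Qed.

(** By [path_insep] a simple path from [x] to [y] only visits vertices inseparable from both ends,
    so it survives in the subgraph. *)
Lemma insep_induced (D : {set G}) (x y : induced D) :
  insep (val x) (val y) ->
  (forall z, insep z (val x) -> insep z (val y) -> z \in D) -> insep x y.
Proof.
move=> xy HD; have L p : path (@adj G) (val x) p -> last (val x) p = val y ->
    exists2 q : seq (induced D), {subset map val q <= p} &
      path (@adj (induced D)) x q /\ last x q = y.
  move=> pp; case: (shortenP pp) => q pq uq qp lq.
  have qD : {subset q <= D}.
    move=> z zq; have zP : z \in val x :: q by rewrite inE zq orbT.
    have [->|zx] := eqVneq z (val x); first exact: (valP x).
    have [->|zy] := eqVneq z (val y); first exact: (valP y).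
    have P := path_insep xy pq lq uq.
    by apply: HD; apply: P; rewrite // -?lq ?mem_last // inE eqxx.
  have [r Er pr] := lift_path pq qD.
  exists r; first by move=> z; rewrite -Er => /qp.
  by split=> //; apply: val_inj; rewrite -lq Er last_map.
apply/insepP; split.
- by apply: contraTneq xy => ->; rewrite insep_irr.
- case/connectP: (insep_connect xy) => p pp Ep.
  by have [r _ [pr <-]] := L p pp (esym Ep); apply/connectP; exists r.
move=> t tx ty; have [xt yt] : val x != val t /\ val y != val t.
  by rewrite !(inj_eq val_inj) 2!(eq_sym _ t).
have [p [[/and3P[pp _ /eqP lp] _] tp]] := linked_induced_path (insep_linked xy xt yt) xt.
have [r rp [pr <-]] := L p pp lp; apply: linked_path => //.
move: tp; rewrite !inE !negb_or (inj_eq val_inj) => /andP[->] /=.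
by apply: contra => tr; apply/rp/map_f.
Qed.

Lemma block_blk x y : insep x y -> block (induced (blk x y)).
Proof.
move=> xy; split.
  apply/connected_without_cut_vertexP; split.
    by apply/card_gt0P; exists (Sub x (blk_l xy)).
  move=> u v uv; have uvI : insep (val u) (val v).
    by apply: (blk_insep xy); rewrite ?(valP u) ?(valP v) // (inj_eq val_inj).
  apply: insep_induced => // z zu zv.
  by apply: (blk_max xy (valP u) (valP v)) => //; apply: insep_neq.
move=> B' cB' [/subsetP sB _]; have sB' : {subset sub_vert B' <= blk x y}.
  have [xB yB] : x \in sub_vert B' /\ y \in sub_vert B'.
    by split; apply: sB; [exact: blk_l | exact: blk_r].
  move=> z zB; have H w : w \in sub_vert B' -> (z == w) || insep z w.
    by move=> wB; case: eqVneq => //= zw; apply: block_insep cB' _ _ _.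
  by rewrite inE !H.
split; first exact/subsetP.
by move=> u v /sub_adj_sub[uB vB uv]; apply/and3P; split; rewrite ?sB'.
Qed.

(** Blocks are induced: adding edges on the same vertices creates no cut vertex, so maximality
    applies to the induced subgraph. *)
Lemma block_adj (B : subgraph G) x y : block B ->
  x \in sub_vert B -> y \in sub_vert B -> x -- y -> sub_adj B x y.
Proof.
case=> cB mB xB yB xy; set I := induced (sub_vert B).
have [||_ H] := mB I; last by apply: H; apply/and3P.
  case/connected_without_cut_vertexP: cB => B0 BI.
  apply/connected_without_cut_vertexP; split=> // u v uv.
  apply: (@insep_homo B I id) (BI u v uv) => // a b ab.
  by apply/and3P; split; [exact: (valP a) | exact: (valP b) |
    case: (sub_adj_sub ab)].
by split=> // u v /sub_adj_sub[uB vB uv]; apply/and3P.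
Qed.

Definition nonedge : rel G := [rel x y | insep x y && ~~ x -- y].

Definition probe_labelling (N1 N2 : {set G}) := [/\ independent N1, independent N2 &
  forall x y, nonedge x y -> (x \in N1 /\ y \in N1) \/ (x \in N2 /\ y \in N2)].

Lemma nonedgeC x y : nonedge x y = nonedge y x.
Proof. by rewrite /nonedge /= insepC adj_sym. Qed.

Lemma nonedge_neq x y : nonedge x y -> x != y.
Proof. by case/andP=> /insep_neq. Qed.

Lemma nonedge_insep x y : nonedge x y -> insep x y.
Proof. by case/andP. Qed.

Lemma nonedge_adj x y : nonedge x y -> ~~ x -- y.
Proof. by case/andP. Qed.

Lemma insep_graph_sym : symmetric (@insep G).
Proof. by move=> x y; rewrite insepC. Qed.

End Blocks.

(** A block supergraph joins every inseparable pair of [G], since the pair stays inseparable and its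
    block is complete. Conversely, joining all inseparable pairs creates no new ones: each added
    edge can be replaced by a path of [G] avoiding the deleted vertex. *)
Lemma two_probe_block_graphP (G : sgraph) :
  two_probe_block_graph G <-> exists N1 N2 : {set G}, probe_labelling N1 N2.
Proof.
split=> [[N1 [N2 [E' [sE [iE [i1 i2 bE GE H]]]]]]|[N1 [N2 [i1 i2 H]]]].
  exists N1, N2; split=> // x y /andP[xy nxy]; apply: H nxy.
  have xy' : @insep (SGraph sE iE) x y.
    by apply: (@insep_homo G (SGraph sE iE) id) xy => // u v; apply: GE.
  have := bE _ (block_blk xy') (Sub x (blk_l xy')) (Sub y (blk_r xy')).
  by case/(_ (insep_neq xy'))/and3P.
exists N1, N2, (@insep G), (@insep_graph_sym G), (@insep_irr G).
split=> //; last 2 first.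
- by move=> x y; apply: adj_insep.
- by move=> x y xy nxy; apply: H; rewrite /nonedge /= xy.
move=> B bB u v uv; apply: (block_adj bB (valP u) (valP v)) => /=.
have := block_insep (proj1 bB) (valP u) (valP v) uv => /insepP[nuv cuv luv].
apply/insepP; split=> //.
  by apply: connect_sub cuv => a b; apply: insep_connect.
move=> t tu tv; apply: connect_sub (luv t tu tv) => a b /and3P[at_ bt ab].
exact: (@insep_linked G t a b ab at_ bt).
Qed.

(** * Nonedges inside blocks *)

(** Deleting one vertex leaves [s] or [t] as a link between [x] and [y]. *)
Lemma nonedge_square (G : sgraph) (s t x y : G) : x != y -> ~~ x -- y -> s != t ->
  x -- s -> y -- s -> x -- t -> y -- t -> nonedge x y.
Proof.
move=> xy nxy st xs ys xt yt; rewrite /nonedge /= nxy andbT.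
have [sy ty] : s -- y /\ t -- y by rewrite adj_sym (adj_sym t).
apply/insepP; split=> //; first by apply: connect_trans (connect1 xs) (connect1 sy).
move=> r rx ry; rewrite eq_sym in rx; rewrite eq_sym in ry.
have [E|sr] := eqVneq s r; last by apply: (linked_trans (y := s)); apply: linked_adj.
have tr : t != r by rewrite -E eq_sym.
by apply: (linked_trans (y := t)); apply: linked_adj.
Qed.

Section LocalConditions.
Variable G : sgraph.
Implicit Types (x y z t u v w a b c d p q : G) (N P Q : {set G}).

(* In terms of the graph of nonedges, these forbid an induced P_4, C_4, K_{1,3},
   P_3 + K_2 and 3 K_2. *)
Definition no_P4 := forall a b c d, nonedge a b -> nonedge b c -> nonedge c d ->
  a -- c -> b -- d -> a -- d -> False.
Definition no_C4 := forall a b c d, nonedge a b -> nonedge b c -> nonedge c d ->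
  nonedge d a -> a -- c -> b -- d -> False.
Definition no_claw := forall c x y z, nonedge c x -> nonedge c y -> nonedge c z ->
  x -- y -> y -- z -> x -- z -> False.
Definition no_P3K2 := forall p c q u v, nonedge p c -> nonedge c q -> p -- q ->
  nonedge u v -> u -- p -> u -- c -> u -- q -> v -- p -> v -- c -> v -- q -> False.
Definition no_3K2 := forall a b c d u v, nonedge a b -> nonedge c d -> nonedge u v ->
  a -- c -> a -- d -> b -- c -> b -- d -> a -- u -> a -- v -> b -- u -> b -- v ->
  c -- u -> c -- v -> d -- u -> d -- v -> False.

Record probe_blocks : Prop := ProbeBlocks {
  pb_P4 : no_P4; pb_C4 : no_C4; pb_claw : no_claw;
  pb_P3K2 : no_P3K2; pb_3K2 : no_3K2 }.

Lemma mem_blk z x y : insep z x -> insep z y -> z \in blk x y.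
Proof. by move=> zx zy; rewrite inE zx zy !orbT. Qed.

Lemma independentP N x y : independent N -> x \in N -> y \in N -> x -- y -> False.
Proof. by move=> iN xN yN xy; move: (iN x y xN yN); rewrite xy. Qed.

Ltac in_block :=
  first [ exact: blk_l | exact: blk_r
        | apply: mem_blk;
          first [ by apply: adj_insep; rewrite // adj_sym
                | by apply: nonedge_insep; rewrite // nonedgeC ] ].

Ltac clash := match goal with xy : is_true (adj _ _), iN : independent _ |- _ =>
    solve [ refine (independentP iN _ _ xy); assumption ] end.

(** Labels are only required block by block, so that this serves a global labelling as well as
    2-probe complete blocks. In each pattern, every assignment of its nonedges to [P] or [Q] puts
    two adjacent vertices in one set. *)
Lemma labelled_probe_blocks :
  (forall x y, insep x y -> exists P Q : {set G},
    [/\ independent P, independent Q &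
        forall z w, z \in blk x y -> w \in blk x y -> nonedge z w ->
          (z \in P /\ w \in P) \/ (z \in Q /\ w \in Q)]) ->
  probe_blocks.
Proof.
move=> L; split.
- move=> a b c d ab bc cd ac bd ad.
  have abI := nonedge_insep ab; have [P [Q [iP iQ H]]] := L a b abI.
  have aD : a \in blk a b by in_block.
  have bD : b \in blk a b by in_block.
  have cD : c \in blk a b by in_block.
  have dD : d \in blk a b by in_block.
  case: (H a b) => // - []; case: (H b c) => // - []; case: (H c d) => // - [] *;
  clash.
- move=> a b c d ab bc cd da ac bd.
  have abI := nonedge_insep ab; have [P [Q [iP iQ H]]] := L a b abI.
  have aD : a \in blk a b by in_block.
  have bD : b \in blk a b by in_block.
  have cD : c \in blk a b by in_block.
  have dD : d \in blk a b by in_block.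
  case: (H a b) => // - []; case: (H b c) => // - []; case: (H c d) => // - [];
  case: (H d a) => // - [] *; clash.
- move=> c x y z cx cy cz xy yz xz.
  have cxI := nonedge_insep cx; have [P [Q [iP iQ H]]] := L c x cxI.
  have cD : c \in blk c x by in_block.
  have xD : x \in blk c x by in_block.
  have yD : y \in blk c x by in_block.
  have zD : z \in blk c x by in_block.
  case: (H c x) => // - []; case: (H c y) => // - []; case: (H c z) => // - [] *;
  clash.
- move=> p c q u v pc cq pq uv up uc uq vp vc vq.
  have pcI := nonedge_insep pc; have [P [Q [iP iQ H]]] := L p c pcI.
  have pD : p \in blk p c by in_block.
  have cD : c \in blk p c by in_block.
  have qD : q \in blk p c by in_block.
  have uD : u \in blk p c by in_block.
  have vD : v \in blk p c by in_block.
  case: (H p c) => // - []; case: (H c q) => // - []; case: (H u v) => // - [] *;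
  clash.
move=> a b c d u v ab cd uv ac ad bc bd au av bu bv cu cv du dv.
have abI := nonedge_insep ab; have [P [Q [iP iQ H]]] := L a b abI.
have aD : a \in blk a b by in_block.
have bD : b \in blk a b by in_block.
have cD : c \in blk a b by in_block.
have dD : d \in blk a b by in_block.
have uD : u \in blk a b by in_block.
have vD : v \in blk a b by in_block.
case: (H a b) => // - []; case: (H c d) => // - []; case: (H u v) => // - [] *;
clash.
Qed.

Lemma blocks_probe_complete_probe_blocks :
  (forall B : subgraph G, block B -> two_probe_complete_graph B) -> probe_blocks.
Proof.
move=> tB; apply: labelled_probe_blocks => x y xy.
have [N1 [N2 [E' [sE [iE [i1 i2 cE BE H]]]]]] := tB _ (block_blk xy).
have iv (N : {set induced (blk x y)}) : independent N -> independent (val @: N).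
  move=> iN _ _ /imsetP[u uN ->] /imsetP[v vN ->]; apply: contra (iN u v uN vN).
  by move=> uv; apply/and3P; split; rewrite ?(valP u) ?(valP v).
exists (val @: N1), (val @: N2); split; [exact: iv | exact: iv |].
move=> z w zD wD zw; pose z' : induced (blk x y) := Sub z zD.
pose w' : induced (blk x y) := Sub w wD.
have zw' : ~~ z' -- w' by rewrite /= /subg_adj /= /ind_adj /= zD wD nonedge_adj.
have nzw : z' != w' by rewrite -(inj_eq val_inj) /= nonedge_neq.
have := H z' w' (cE _ _ nzw) zw'.
by case=> - [zN wN]; [left|right]; rewrite -[z]/(val z') -[w]/(val w') !imset_f.
Qed.

Lemma insep_cases z w : insep z w -> z -- w \/ nonedge z w.
Proof. by move=> zw; rewrite /nonedge /= zw; case: (z -- w); [left | right]. Qed.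

Lemma blk_cases x y z w : insep x y -> z \in blk x y -> w \in blk x y ->
  [\/ z = w, z -- w | nonedge z w].
Proof.
move=> xy zD wD; have [->|zw] := eqVneq z w; first by constructor 1.
by case: (insep_cases (blk_insep xy zD wD zw)); [constructor 2 | constructor 3].
Qed.

(** [t] does not separate [x] from [y]; an induced path avoiding it has length exactly 2, and [s] is
    its middle. *)
Lemma common_neighbour_avoid t x y : nonedge x y -> x != t -> y != t ->
  (forall p : seq G, induced_path x y p -> size p <= 2) ->
  exists s, [/\ s != t, x -- s & s -- y].
Proof.
move=> xy xt yt short.
have [p [ip tp]] := linked_induced_path (insep_linked (nonedge_insep xy) xt yt) xt.
have := short p ip; case: ip => /and3P[pp _ /eqP lp] _.
case: p pp lp tp => [|s [|z [|? ?]]] //=.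
- by move=> _ E; move: (nonedge_neq xy); rewrite E eqxx.
- by move=> xs E; move: (nonedge_adj xy); rewrite -E; move: xs; rewrite andbT => ->.
rewrite !inE !negb_or andbT => /andP[xs sz] E /and3P[_ ts _] _.
by exists s; rewrite xs -E sz eq_sym ts.
Qed.

Lemma common_neighbours x y : nonedge x y ->
  (forall p : seq G, induced_path x y p -> size p <= 2) ->
  exists s t, [/\ s != t, x -- s, s -- y, x -- t & t -- y].
Proof.
move=> xy short; have /connectP[[|z p] /=] := insep_connect (nonedge_insep xy).
  by move=> _ E; move: (nonedge_neq xy); rewrite E eqxx.
case/andP=> xz _ _.
have yz : y != z.
  by apply: contraTneq xz => <-; exact: nonedge_adj.
have [s [_ xs sy]] := common_neighbour_avoid xy (adj_neq xz) yz short.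
have [|t [ts xt ty]] := common_neighbour_avoid xy (adj_neq xs) _ short.
  by rewrite eq_sym adj_neq.
by exists s, t; split; rewrite // eq_sym.
Qed.

(** The first four vertices [x], [a], [b], [c] of a longer induced path are pairwise inseparable,
    and the complement of a P_4 is the P_4 [b x c a]. *)
Lemma no_P4_short : no_P4 -> forall x y (p : seq G), insep x y -> induced_path x y p ->
  size p <= 2.
Proof.
move=> H x y p xy [/and3P[pp up /eqP lp] ip]; rewrite leqNgt; apply/negP.
case: p pp up lp ip => [|a [|b [|c p]]] // pp up lp ip _.
have I u v := path_insep xy pp lp up.
have := up; rewrite /= !inE !negb_or -!andbA => /and4P[xa xb xc].
case/and4P=> _ ab ac /and3P[_ bc _].
have := pp; rewrite /= => /and4P[axa aab abc _].
have nxb : ~~ x -- b by apply/negP=> E; have := ip 0 2 isT E.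
have nxc : ~~ x -- c by apply/negP=> E; have := ip 0 3 isT E.
have nac : ~~ a -- c by apply/negP=> E; have := ip 1 3 isT E.
apply: (H b x c a) => //; rewrite /nonedge /= ?nxc ?(adj_sym b x) ?nxb
  ?(adj_sym c a) ?nac ?andbT ?(adj_sym b a) //;
  by apply: I; rewrite // ?inE ?eqxx ?orbT // eq_sym.
Qed.

Lemma nonedge_short : no_P4 -> forall x y (p : seq G), nonedge x y ->
  induced_path x y p -> size p <= 2.
Proof. by move=> P4 x y p /nonedge_insep; apply: no_P4_short. Qed.

Lemma neq_by_adj x y z : x -- z -> ~~ y -- z -> x != y.
Proof. by move=> xz; apply: contraNneq => <-. Qed.

(* Otherwise y x u c would be a P_4. *)
Lemma neighbour_adj c x y u : no_P4 -> nonedge c x -> nonedge c y -> x -- y ->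
  c -- u -> u -- x -> u -- y.
Proof.
move=> P4 cx cy xy cu ux; have yc : nonedge y c by rewrite nonedgeC.
have uy : insep u y.
  have nuy : u != y by apply: (neq_by_adj (z := c)); rewrite adj_sym ?nonedge_adj.
  apply/insepP; split=> //; first by apply: connect_trans (connect1 ux) (connect1 xy).
  move=> t tu ty; have [->|tx] := eqVneq t x.
    apply: (linked_trans (y := c)).
      by apply: linked_adj; [rewrite adj_sym | exact: adj_neq | exact: nonedge_neq].
    apply: insep_linked; [exact: nonedge_insep | exact: nonedge_neq |].
    by rewrite eq_sym adj_neq.
  by apply: (linked_trans (y := x)); apply: linked_adj; rewrite // eq_sym.
case: (insep_cases uy) => // {}uy; exfalso.
by apply: (P4 _ _ _ _ uy yc cx); rewrite // adj_sym.
Qed.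

(** The closed neighbourhood in the graph of nonedges; the covering cliques are chosen of this
    form. *)
Definition close p : {set G} := [set z | (z == p) || nonedge p z].

Lemma closeP p z : reflect (z = p \/ nonedge p z) (z \in close p).
Proof. by rewrite inE; apply: (iffP orP) => [] []; [move/eqP|..]; auto => ->; left. Qed.

End LocalConditions.

(** * Covering the nonedges of a block by two cliques *)

Section TwoCliques.
Variable G : sgraph.
Hypothesis pbG : probe_blocks G.
Variables x0 y0 : G.
Hypothesis xy0 : insep x0 y0.
Local Notation D := (blk x0 y0).
Implicit Types (x y z t u v w a b c d p q : G) (N P Q : {set G}).

Let P4 := pb_P4 pbG.
Let C4 := pb_C4 pbG.
Let claw := pb_claw pbG.
Let P3K2 := pb_P3K2 pbG.
Let K222 := pb_3K2 pbG.

(** Here [p c q] is an induced P_3 of the graph of nonedges. A neighbour of [p] there is [c] or a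
    neighbour of [c], by absence of P_4 and C_4. Two such neighbours not joined by a nonedge would
    form, with [c], [p] and [q], a claw centred at [c], a P_4 or a C_4. *)
Lemma close_clique p c q z w : p \in D -> c \in D -> q \in D ->
  nonedge p c -> nonedge c q -> p -- q ->
  z \in D -> w \in D -> z \in close p -> w \in close p -> z = w \/ nonedge z w.
Proof.
move=> pD cD qD pc cq pq zD wD /closeP[->|pz] /closeP[->|pw]; auto.
  by right; rewrite nonedgeC.
have key u : u \in D -> nonedge p u -> u = c \/ nonedge c u.
  move=> uD pu; case: (blk_cases xy0 uD cD) => [|uc|]; auto; last first.
    by rewrite nonedgeC; auto.
  exfalso; have nup : nonedge u p by rewrite nonedgeC.
  case: (blk_cases xy0 uD qD) => [E|uq|uq].
  - by move: (nonedge_adj pu); rewrite E pq.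
  - by apply: (P4 nup pc cq).
  - by apply: (C4 pc cq (_ : nonedge q u)); rewrite // 1?nonedgeC // adj_sym.
have [->|cz] := key z zD pz; first by have [->|] := key w wD pw; auto.
have [->|cw] := key w wD pw; first by right; rewrite nonedgeC.
case: (blk_cases xy0 zD wD) => [|zw|]; auto; exfalso.
have nzp : nonedge z p by rewrite nonedgeC.
have nwp : nonedge w p by rewrite nonedgeC.
have [wz qp] : w -- z /\ q -- p by rewrite adj_sym (adj_sym q).
case: (blk_cases xy0 qD zD) => [E|qz|qz].
- by move: (nonedge_adj pz); rewrite -E pq.
- case: (blk_cases xy0 qD wD) => [E|qw|qw].
  + by move: (nonedge_adj pw); rewrite -E pq.
  + exact: (claw cq cz cw).
  + exact: (P4 qw nwp pz).
- case: (blk_cases xy0 qD wD) => [E|qw|qw].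
  + by move: (nonedge_adj pw); rewrite -E pq.
  + exact: (P4 qz nzp pw).
  + by apply: (C4 qz nzp pw) => //; rewrite nonedgeC.
Qed.

(** Any other outcome leaves a P_4, a C_4 or a claw among the nonedges on [p], [c], [q], [u],
    [v]. *)
Lemma close_coverW p c q u v : p \in D -> c \in D -> q \in D ->
  nonedge p c -> nonedge c q -> p -- q -> u \in D -> v \in D -> nonedge u v ->
  u != c -> v != c -> nonedge u p -> v \notin close p ->
  u \in close q /\ v \in close q.
Proof.
move=> pD cD qD pc cq pq uD vD uv uc vc up vp.
have cp : nonedge c p by rewrite nonedgeC.
have qc : nonedge q c by rewrite nonedgeC.
have pu : nonedge p u by rewrite nonedgeC.
have vu : nonedge v u by rewrite nonedgeC.
have qp : q -- p by rewrite adj_sym.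
have pv : p -- v.
  case: (blk_cases xy0 pD vD) => // [E|E]; case/negP: vp; apply/closeP; auto.
have vp' : v -- p by rewrite adj_sym.
case: (blk_cases xy0 cD vD) => [E|cv|cv]; first by rewrite E eqxx in vc.
  have vc' : v -- c by rewrite adj_sym.
  case: (blk_cases xy0 uD qD) => [E|uq|uq].
  - by rewrite -E; split; apply/closeP; auto.
  - case: (blk_cases xy0 uD cD) => [E|uc'|uc'].
    + by rewrite E eqxx in uc.
    + by case: (P4 up pc cq).
    + case: (blk_cases xy0 vD qD) => [E|vq|vq].
      * by move: (nonedge_adj cq); rewrite -E cv.
      * by case: (P4 vu uc' cq).
      * by case: (C4 vu uc' cq (_ : nonedge q v)); rewrite // nonedgeC.
  - case: (blk_cases xy0 vD qD) => [E|vq|vq].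
    + by rewrite -E; split; apply/closeP; auto.
    + by case: (claw uv up uq).
    + by split; apply/closeP; right; rewrite nonedgeC.
case: (blk_cases xy0 vD qD) => [E|vq|vq].
- by rewrite -E; split; apply/closeP; auto.
- by case: (claw cv cp cq).
case: (blk_cases xy0 uD qD) => [E|uq|uq].
- by rewrite -E; split; apply/closeP; auto.
- by case: (P4 pu uv vq).
- by split; apply/closeP; right; rewrite nonedgeC.
Qed.

(** Nonedges at [c] are covered because there is no claw ([centre]), those meeting one of the two
    sets by [close_coverW] ([side]), and a nonedge missing both would form P_3 + K_2 with [p c q]
    ([far]). *)
Lemma close_cover p c q u v : p \in D -> c \in D -> q \in D ->
  nonedge p c -> nonedge c q -> p -- q -> u \in D -> v \in D -> nonedge u v ->
  (u \in close p /\ v \in close p) \/ (u \in close q /\ v \in close q).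
Proof.
move=> pD cD qD pc cq pq uD vD uv.
have cp : nonedge c p by rewrite nonedgeC.
have qc : nonedge q c by rewrite nonedgeC.
have vu : nonedge v u by rewrite nonedgeC.
have qp : q -- p by rewrite adj_sym.
have centre z : z \in D -> nonedge c z -> z \in close p \/ z \in close q.
  move=> zD cz; case: (blk_cases xy0 zD pD) => [->|zp|zp].
  - by left; apply/closeP; left.
  - case: (blk_cases xy0 zD qD) => [->|zq|zq].
    + by right; apply/closeP; left.
    + by case: (claw cz cp cq).
    + by right; apply/closeP; right; rewrite nonedgeC.
  - by left; apply/closeP; right; rewrite nonedgeC.
have cp' : c \in close p by apply/closeP; right.
have cq' : c \in close q by apply/closeP; right.
have [Ec|uc] := eqVneq u c.
  by rewrite Ec in uv *; case: (centre v vD uv); auto.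
have [Ec|vc] := eqVneq v c.
  by rewrite Ec in vu *; case: (centre u uD vu); auto.
have far z : z \in D -> z \notin close p -> z \notin close q ->
    [/\ z -- p, z -- q & z -- c \/ z = c].
  move=> zD zp zq; split.
  - case: (blk_cases xy0 pD zD) => [E|E|E]; last 2 first.
    + by rewrite adj_sym.
    + by case/negP: zp; apply/closeP; right.
    by case/negP: zp; apply/closeP; left.
  - case: (blk_cases xy0 qD zD) => [E|E|E]; last 2 first.
    + by rewrite adj_sym.
    + by case/negP: zq; apply/closeP; right.
    by case/negP: zq; apply/closeP; left.
  case: (blk_cases xy0 zD cD) => [|?|cz]; auto; rewrite nonedgeC in cz.
  by case: (centre z zD cz) => E; [rewrite E in zp | rewrite E in zq].
have side z w : z \in D -> w \in D -> nonedge z w -> z != c -> w != c ->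
    z \in close p \/ z \in close q ->
    (z \in close p /\ w \in close p) \/ (z \in close q /\ w \in close q).
  move=> zD wD zw zc wc.
  have [wp|wp] := boolP (w \in close p); have [wq|wq] := boolP (w \in close q).
  - by case; auto.
  - case; auto => /closeP[E|qz].
      by case/negP: wq; apply/closeP; right; rewrite -E.
    left; rewrite nonedgeC in qz.
    by have [] := close_coverW qD cD pD qc cp qp zD wD zw zc wc qz wq.
  - case; auto => /closeP[E|pz].
      by case/negP: wp; apply/closeP; right; rewrite -E.
    right; rewrite nonedgeC in pz.
    by have [] := close_coverW pD cD qD pc cq pq zD wD zw zc wc pz wp.
  case=> /closeP[E|].
  - by case/negP: wp; apply/closeP; right; rewrite -E.
  - rewrite nonedgeC => pz; have := close_coverW pD cD qD pc cq pq zD wD zw zc wc pz wp.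
    by rewrite (negPf wq) => -[].
  - by case/negP: wq; apply/closeP; right; rewrite -E.
  - rewrite nonedgeC => qz; have := close_coverW qD cD pD qc cp qp zD wD zw zc wc qz wq.
    by rewrite (negPf wp) => -[].
have /orP[up|up] := orbN (u \in close p); first by apply: side; auto.
have /orP[uq|uq] := orbN (u \in close q); first by apply: side; auto.
have /orP[vp|vp] := orbN (v \in close p).
  by case: (side v u) => //; [left | case; auto | case; auto].
have /orP[vq|vq] := orbN (v \in close q).
  by case: (side v u) => //; [right | case; auto | case; auto].
have [a1 a2 [a3|E]] := far u uD up uq; last by rewrite E eqxx in uc.
have [b1 b2 [b3|E]] := far v vD vp vq; last by rewrite E eqxx in vc.
by case: (P3K2 pc cq pq uv).
Qed.

(** If the graph of nonedges has an induced P_3, the closed neighbourhoods of its ends serve.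
    Otherwise it is a disjoint union of cliques, of which at most two have an edge because 3 K_2 is
    excluded. *)
Lemma two_cliques : exists P Q : {set G},
  [/\ P \subset D, Q \subset D,
      {in P &, forall z w, z = w \/ nonedge z w},
      {in Q &, forall z w, z = w \/ nonedge z w} &
      {in D &, forall z w, nonedge z w ->
         (z \in P /\ w \in P) \/ (z \in Q /\ w \in Q)}].
Proof.
have [/exists_inP[p pD /exists_inP[c cD /exists_inP[q qD /and3P[pc cq pq]]]]|n3] :=
  boolP [exists p in D, exists c in D, exists q in D,
    [&& nonedge p c, nonedge c q & p -- q]].
  have cp : nonedge c p by rewrite nonedgeC.
  have qc : nonedge q c by rewrite nonedgeC.
  have qp : q -- p by rewrite adj_sym.
  exists (close p :&: D), (close q :&: D); split; try exact: subsetIr.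
  - move=> z w /setIP[zp zD] /setIP[wp wD].
    exact: (close_clique pD cD qD pc cq pq).
  - move=> z w /setIP[zp zD] /setIP[wp wD].
    exact: (close_clique qD cD pD qc cp qp).
  move=> z w zD wD zw; rewrite !in_setI zD wD !andbT.
  exact: (close_cover pD cD qD pc cq pq zD wD zw).
have tr p c q : p \in D -> c \in D -> q \in D -> nonedge p c -> nonedge c q ->
    p = q \/ nonedge p q.
  move=> pD cD qD pc cq; case: (blk_cases xy0 pD qD) => [|pq|]; auto.
  case/negP: n3; apply/exists_inP; exists p => //; apply/exists_inP; exists c => //.
  by apply/exists_inP; exists q => //; apply/and3P.
have cl p : {in close p :&: D &, forall z w, p \in D -> z = w \/ nonedge z w}.
  move=> z w /setIP[/closeP[->|pz] zD] /setIP[/closeP[->|pw] wD] pD; auto.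
    by right; rewrite nonedgeC.
  by apply: (tr z p w); rewrite // nonedgeC.
have ad p z w : p \in D -> z \in D -> w \in D -> nonedge z w ->
    ~~ ((z \in close p :&: D) && (w \in close p :&: D)) -> p -- z /\ p -- w.
  move=> pD zD wD zw; rewrite !in_setI zD wD !andbT !in_set => H.
  have wz : nonedge w z by rewrite nonedgeC.
  case: (blk_cases xy0 pD zD) => [E|pz|pz].
  - by move: H; rewrite -E eqxx /= E zw orbT.
  - split=> //; case: (blk_cases xy0 pD wD) => // [E|pw].
    + by move: H; rewrite -E eqxx /= E wz orbT.
    + case: (tr p w z) => // E.
        by move: pz; rewrite E adj_irr.
      by move: (nonedge_adj E); rewrite pz.
  - case: (tr p z w) => // E; move: H; first by rewrite E eqxx wz !orbT.
    by rewrite pz E !orbT.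
have [/exists_inP[p pD /exists_inP[p' pD' pp]]|n1] :=
  boolP [exists p in D, exists p' in D, nonedge p p']; last first.
  exists set0, set0; split; rewrite ?sub0set //; try by move=> z w; rewrite inE.
  move=> z w zD wD zw; case/negP: n1; apply/exists_inP; exists z => //.
  by apply/exists_inP; exists w.
have [/exists_inP[q qD /exists_inP[q' qD' /andP[qq nP]]]|n1] :=
  boolP [exists q in D, exists q' in D, nonedge q q' &&
    ~~ ((q \in close p :&: D) && (q' \in close p :&: D))]; last first.
  exists (close p :&: D), set0; split; rewrite ?sub0set ?subsetIr //.
  - by move=> z w zP wP; apply: (cl p).
  - by move=> z w; rewrite inE.
  move=> z w zD wD zw; left; apply/andP/negPn/negP => H; case/negP: n1.
  by apply/exists_inP; exists z => //; apply/exists_inP; exists w; rewrite // zw.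
exists (close p :&: D), (close q :&: D); split; rewrite ?sub0set ?subsetIr //.
- by move=> z w zP wP; apply: (cl p).
- by move=> z w zP wP; apply: (cl q).
move=> z w zD wD zw.
have [/andP|zwp] := boolP ((z \in close p :&: D) && (w \in close p :&: D)); auto.
have [/andP|zwq] := boolP ((z \in close q :&: D) && (w \in close q :&: D)); auto.
exfalso; have [pq pq'] := ad p q q' pD qD qD' qq nP.
have [pz pw] := ad p z w pD zD wD zw zwp.
have [qz qw] := ad q z w qD zD wD zw zwq.
(* Without an induced P_3, vertices joined by a nonedge have the same neighbours in [D]; so the
   three nonedges found are completely joined in [G]. *)
have opp a b c : a \in D -> b \in D -> c \in D -> nonedge a b -> a -- c ->
    b -- c.
  move=> aD bD cD ab ac; case: (blk_cases xy0 bD cD) => // [E|bc].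
    by move: (nonedge_adj ab); rewrite E ac.
  case: (tr a b c) => // E; first by rewrite E adj_irr in ac.
  by move: (nonedge_adj E); rewrite ac.
apply: (K222 pp qq zw) => //; by
  [apply: (opp p) | apply: (opp q)].
Qed.

End TwoCliques.

(** * Gluing signs along the blocks *)

Section Potential.
(** [e x y] is meant to tell whether [x] and [y] differ in the colouring of their block. The
    triangle identity makes it a cocycle on each block, and the potential [l] is the global
    colouring. *)
Variables (G : sgraph) (e : G -> G -> bool).
Hypothesis eC : forall x y, e x y = e y x.
Hypothesis e_triangle : forall x y z, insep x y -> insep y z -> insep x z ->
  e x z = e x y (+) e y z.

(* The potential is extended one vertex at a time along sets A meeting each
   component in a connected set: the vertices of A inseparable from a new vertex
   are then pairwise inseparable. *)
Lemma insep_potential : exists l : G -> bool, forall x y, insep x y ->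
  e x y = l x (+) l y.
Proof.
pose closed_ (A : {set G}) := forall x y, x \in A -> y \in A ->
  connect (@adj G) x y -> connect (ind_adj A) x y.
suff [A [cA sA [l Hl]]] : exists A : {set G}, [/\ closed_ A, #|A| = #|G| &
    exists l : G -> bool, {in A &, forall x y, insep x y -> e x y = l x (+) l y}].
  have AT x : x \in A.
    suff -> : A = [set: G] by rewrite inE.
    by apply/eqP; rewrite eqEcard subsetT cardsT sA leqnn.
  by exists l => x y; apply: Hl.
suff: forall n, n <= #|G| -> exists A : {set G}, [/\ closed_ A, #|A| = n &
    exists l : G -> bool, {in A &, forall x y, insep x y -> e x y = l x (+) l y}].
  by apply.
elim=> [_|n IH ltn].
  exists set0; split; rewrite ?cards0 //; first by move=> x y; rewrite inE.
  by exists xpred0 => x y; rewrite inE.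
have [A [cA sA [l Hl]]] := IH (ltnW ltn).
(* The new vertex is a neighbour of [A] if there is one; otherwise [A] is a union of components and
   any vertex starts a new one. *)
have [v vA Hv] : exists2 v, v \notin A & (exists2 a, a \in A & v -- a) \/
    (forall a z, a \in A -> z \notin A -> ~~ a -- z).
  have [/existsP[v /andP[vA /exists_inP[a aA va]]]|N] :=
    boolP [exists v, (v \notin A) && [exists a in A, v -- a]].
    by exists v => //; left; exists a.
  have /subsetPn[v _ vA] : ~~ ([set: G] \subset A).
    by apply: contraL ltn => /subset_leq_card; rewrite cardsT sA -leqNgt.
  exists v => //; right=> a z aA zA; apply: contra N => az; apply/existsP; exists z.
  by rewrite zA; apply/exists_inP; exists a; rewrite // adj_sym.
exists (v |: A); split; last first.
(* The value at [v] is forced by any [p] in [A] inseparable from it; if there is none, it is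
   arbitrary. *)
- exists (fun z => if z == v then
    if [pick p in A | insep v p] is Some p then e v p (+) l p else false
    else l z).
  have key q : q \in A -> insep v q ->
      e v q = (if [pick p in A | insep v p] is Some p then e v p (+) l p
               else false) (+) l q.
    move=> qA vq; case: pickP => [p /andP[pA vp]|/(_ q)]; last by rewrite qA vq.
    have [->|pq] := eqVneq p q; first by rewrite -addbA addbb addbF.
    have lpq : linked v p q.
      have cpq : connect (@adj G) p q.
        by apply: connect_trans (insep_connect vq); rewrite connectC insep_connect.
      apply: connect_sub (cA _ _ pA qA cpq) => x y /and3P[xA yA xy].
      by apply: linked_adj => //; [apply: contraNneq vA => <-..].
    have pqI := linked_insep vp vq lpq pq.
    by rewrite (e_triangle vp pqI vq) (Hl p q) // addbA.
  move=> x y; rewrite !inE; case: eqVneq => [->|xv] /=; case: eqVneq => [->|yv] //=.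
  + by rewrite insep_irr.
  + by move=> _; apply: key.
  + by move=> xA _ xv'; rewrite eC key // 1?insepC // addbC.
  + exact: Hl.
- by rewrite cardsU1 vA sA.
have subA x y : connect (ind_adj A) x y -> connect (ind_adj (v |: A)) x y.
  apply: connect_sub => a b /and3P[aA bA ab]; apply: connect1.
  by rewrite /ind_adj /= !inE aA bA !orbT.
have vq q : q \in A -> connect (@adj G) v q -> connect (ind_adj (v |: A)) v q.
  move=> qA cvq; case: Hv => [[a aA va]|N].
    apply: (connect_trans (y := a)).
      by apply: connect1; rewrite /ind_adj /= !inE eqxx aA orbT.
    apply/subA/cA => //; apply: connect_trans cvq; apply: connect1.
    by rewrite adj_sym.
  exfalso; move/negP: vA; apply; rewrite connectC in cvq.
  case/connectP: cvq => p; elim: p q qA => [|z p IHp] q qA /=; first by move=> _ ->.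
  case/andP=> qz; apply: IHp; apply/negPn/negP=> zA.
  by move: (N q z qA zA); rewrite qz.
have sC : connect_sym (ind_adj (v |: A)) by apply/sym_connect_sym/ind_adj_sym.
move=> x y; rewrite !inE => /orP[/eqP->|xA] /orP[/eqP->|yA] // cxy.
- exact: vq.
- by rewrite sC vq // connectC.
- exact/subA/cA.
Qed.

End Potential.

(** * Embeddings of glued graphs *)

Definition embedding (H G : sgraph) (f : H -> G) :=
  injective f /\ forall x y, f x -- f y = x -- y.

(** Induced copies become maps out of [H], which can be composed and glued. *)
Lemma freeP (F : seq sgraph) (G : sgraph) :
  free F G <-> forall H, List.In H F -> forall f : H -> G, ~ embedding f.
Proof.
split=> [fr H HF f [fI fE]|fr H A HF [h [k hK kK] hE]]; last first.
  apply: (fr H HF (val \o k)); split=> [|x y].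
    exact: (inj_comp val_inj (can_inj kK)).
  have := hE (k x) (k y); rewrite !kK => -> /=.
  by rewrite /subg_adj /= /ind_adj /= (valP (k x)) (valP (k y)).
have fA x : f x \in [set f x | x : H] by apply: imset_f.
pose k x : induced [set f x | x : H] := Sub (f x) (fA x).
have kI : injective k by move=> x y /(congr1 val)/fI.
have /(inj_card_bij kI) kB : #|induced [set f x | x : H]| <= #|H|.
  rewrite card_sig; apply: leq_trans (leq_imset_card f _).
  by apply: subset_leq_card; apply/subsetP=> x; rewrite !inE.
case: kB => h kK hK; apply: (fr H [set f x | x : H] HF); exists h.
  by exists k.
move=> x y; rewrite -{2}(hK x) -{2}(hK y) /= /subg_adj /= /ind_adj /=.
by rewrite !fA /= fE.
Qed.

Lemma embedding_comp (H G K : sgraph) (f : G -> K) (g : H -> G) :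
  embedding f -> embedding g -> embedding (f \o g).
Proof.
move=> [fI fE] [gI gE]; split; first exact: inj_comp.
by move=> x y; rewrite /= fE gE.
Qed.

Lemma insep_embedding (H G : sgraph) (f : H -> G) x y :
  embedding f -> insep x y -> insep (f x) (f y).
Proof. by case=> fI fE; apply: insep_homo => // u v; rewrite fE. Qed.

Lemma linked_embedding (H G : sgraph) (f : H -> G) t x y :
  embedding f -> linked t x y -> linked (f t) (f x) (f y).
Proof.
case=> fI fE; apply: linked_homo => [u v|u]; first by rewrite fE.
by rewrite (inj_eq fI).
Qed.

(** Deleting [u] leaves all other vertices in one component. Hence a single separated pair of
    vertices separates whole pieces. *)
Definition noncut (G : sgraph) (u : G) :=
  forall x y, x != u -> y != u -> linked u x y.

Lemma noncut_universal (G : sgraph) (u z : G) :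
  z != u -> (forall x, (x == z) || x -- z) -> noncut u.
Proof.
move=> zu H; have L x : x != u -> linked u x z.
  by move=> xu; case/orP: (H x) => [/eqP->|xz]; [exact: connect0 | exact: linked_adj].
by move=> x y xu yu; apply: linked_trans (L x xu) _; rewrite linkedC L.
Qed.

Lemma noncut_connect (G : sgraph) (u z : G) : noncut u -> u -- z ->
  forall x, connect (@adj G) u x.
Proof.
move=> nu uz x; have [->|xu] := eqVneq x u; first exact: connect0.
apply: connect_trans (connect1 uz) (linked_connect (nu _ _ _ xu)).
by rewrite eq_sym adj_neq.
Qed.

Lemma separated (G : sgraph) (t a b x y : G) : ~~ linked t a b ->
  a != t -> b != t -> linked t a x -> linked t b y -> x != y /\ ~~ x -- y.
Proof.
move=> nab at_ bt ax by_; split.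
  apply: contraNneq nab => E; apply: linked_trans ax _; rewrite E linkedC; exact: by_.
apply: contra nab => xy; apply: (linked_trans ax).
apply: (linked_trans (y := y)); last by rewrite linkedC.
by apply: linked_adj => //; [exact: (linked_neq ax) | exact: (linked_neq by_)].
Qed.

Section Glue.
Variables (G H : sgraph) (u : G) (v : H).

(** The inclusion of the second graph, whose vertex [v] is represented by [inl u]. *)
Definition glue_right (y : H) : glue u v :=
  if insub y is Some z then inr (z : {y : H | y != v}) else inl u.

Lemma glue_right_pt : glue_right v = inl u.
Proof. by rewrite /glue_right insubF ?eqxx. Qed.

Lemma glue_right_val (z : {y : H | y != v}) : glue_right (val z) = inr z.
Proof. by rewrite /glue_right valK. Qed.

Lemma glue_rightP (P : H -> Prop) : P v -> (forall z : {y : H | y != v}, P (val z)) ->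
  forall y, P y.
Proof.
by move=> Pv Pz y; have [->//|yv] := eqVneq y v; apply: (Pz (Sub y yv)).
Qed.

Lemma embedding_inl : embedding (inl : G -> glue u v).
Proof. by split=> [x y []|]. Qed.

Lemma embedding_glue_right : embedding glue_right.
Proof.
split.
  apply: glue_rightP => [|z]; apply: glue_rightP => [|z'] //;
    rewrite ?glue_right_pt ?glue_right_val //; by case=> ->.
apply: glue_rightP => [|z]; apply: glue_rightP => [|z'] //;
  rewrite ?glue_right_pt ?glue_right_val //= ?adj_irr ?eqxx //.
by rewrite adj_sym.
Qed.

Lemma glue_notin x y : x != u -> glue_right y != inl x.
Proof.
move=> xu; move: y; apply: glue_rightP => [|z].
  by rewrite glue_right_pt; apply: contraNneq xu => -[->].
by rewrite glue_right_val.
Qed.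

(** The second graph hangs connectedly at [u], which survives the deletion of [x]. This permits
    repeated gluing. *)
Lemma noncut_glue x : noncut x -> x != u ->
  (forall y, connect (@adj H) v y) -> noncut (inl x : glue u v).
Proof.
move=> nx xu cv; have L z : z != inl x -> linked (inl x : glue u v) (inl u) z.
  case: z => [y yx|y _].
    apply: linked_embedding embedding_inl _; apply: nx; first by rewrite eq_sym.
    by apply: contraNneq yx => ->.
  rewrite -glue_right_pt -glue_right_val.
  apply: connect_linked (cv (val y)) => [a b ab|a]; last exact: glue_notin.
  by rewrite (proj2 embedding_glue_right).
move=> y z yx zx; apply: linked_trans (L z zx); rewrite linkedC; exact: L.
Qed.

Variables (K : sgraph) (f : G -> K) (g : H -> K).

Definition glue_map (x : glue u v) : K :=
  match x with inl x => f x | inr y => g (val y) end.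

(** One separated pair [x0], [y0] is enough: since [u] and [v] are [noncut], the rest of each image
    lies in a single component once [f u] is deleted, so the images meet only there and have no
    further edges between them. *)
Lemma embedding_glue x0 y0 : embedding f -> embedding g -> f u = g v ->
  noncut u -> noncut v ->
  x0 != u -> y0 != v -> ~~ linked (f u) (f x0) (g y0) -> embedding glue_map.
Proof.
move=> fE gE E nu nv x0u y0v sep.
have S x y : x != u -> y != v -> f x != g y /\ ~~ f x -- g y.
  move=> xu yv; apply: (separated sep).
  - by rewrite (inj_eq (proj1 fE)).
  - by rewrite E (inj_eq (proj1 gE)).
  - exact/(linked_embedding fE)/nu.
  - by rewrite E; apply/(linked_embedding gE)/nv.
have R x (y : {y : H | y != v}) : f x != g (val y) /\
    f x -- g (val y) = (x == u) && v -- val y.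
  have [->|xu] := eqVneq x u; last first.
    by have [? /negPf->] := S x (val y) xu (valP y).
  by rewrite E (proj2 gE) (inj_eq (proj1 gE)) eq_sym (valP y).
split=> [[x|x] [y|y] /= Exy|[x|x] [y|y] /=].
- by rewrite (proj1 fE _ _ Exy).
- by have [] := R x y; rewrite Exy eqxx.
- by have [] := R y x; rewrite Exy eqxx.
- by rewrite (val_inj (proj1 gE _ _ Exy)).
- by rewrite (proj2 fE).
- by have [] := R x y.
- by have [] := R y x; rewrite adj_sym.
- by rewrite (proj2 gE).
Qed.

End Glue.

Section Link.
Variables (G H : sgraph) (u : G) (v : H).

Lemma embedding_link_l : embedding (inl : G -> link u v).
Proof. by split=> [x y []|]. Qed.

Lemma embedding_link_r : embedding (inr : H -> link u v).
Proof. by split=> [x y []|]. Qed.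

Variables (K : sgraph) (f : G -> K) (g : H -> K).

Definition link_map (x : link u v) : K :=
  match x with inl x => f x | inr y => g y end.

(** As for gluing, with a separation at each end of the linking edge: at [f u] it isolates the rest
    of the first image, at [g v] the rest of the second. *)
Lemma embedding_link x0 y0 : embedding f -> embedding g -> f u -- g v ->
  noncut u -> noncut v ->
  (forall y, connect (@adj H) v y) ->
  x0 != u -> y0 != v -> ~~ linked (f u) (f x0) (g v) ->
  ~~ linked (g v) (f u) (g y0) -> embedding link_map.
Proof.
move=> fE gE E nu nv cv x0u y0v sepu sepv.
have fgu : f u != g v by exact: adj_neq.
have Sv y : y != v -> f u != g y /\ ~~ f u -- g y.
  move=> yv; apply: (separated sepv) => //; rewrite ?(inj_eq (proj1 gE)) //.
  - exact: connect0.
  - exact/(linked_embedding gE)/nv.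
have fu y : g y != f u.
  by rewrite eq_sym; have [->//|/Sv[]] := eqVneq y v.
have Su x y : x != u -> f x != g y /\ ~~ f x -- g y.
  move=> xu; apply: (separated sepu); rewrite ?(inj_eq (proj1 fE)) //.
  - exact/(linked_embedding fE)/nu.
  - by apply: connect_linked (cv y) => [a b ab|a]; rewrite ?(proj2 gE).
have R x y : f x != g y /\ f x -- g y = (x == u) && (y == v).
  have [->|xu] := eqVneq x u; last by have [? /negPf->] := Su x y xu.
  have [->|yv] := eqVneq y v; first by rewrite E.
  by have [? /negPf->] := Sv y yv.
split=> [[x|x] [y|y] /= Exy|[x|x] [y|y] /=].
- by rewrite (proj1 fE _ _ Exy).
- by have [] := R x y; rewrite Exy eqxx.
- by have [] := R y x; rewrite Exy eqxx.
- by rewrite (proj1 gE _ _ Exy).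
- by rewrite (proj2 fE).
- by have [] := R x y.
- by have [] := R y x; rewrite adj_sym.
- by rewrite (proj2 gE).
Qed.

End Link.

Lemma embeddingI (H G : sgraph) (f : H -> G) :
  (forall x y, x != y -> f x != f y /\ f x -- f y = x -- y) -> embedding f.
Proof.
move=> E; split=> x y.
  by move=> Exy; apply/eqP/negPn/negP=> /E[]; rewrite Exy eqxx.
by have [->|/E[]//] := eqVneq x y; rewrite !adj_irr.
Qed.

Ltac edge := solve [ assumption | rewrite adj_sym; assumption
  | apply: negbTE; assumption | apply: negbTE; rewrite adj_sym; assumption
  | apply: adj_neq; assumption | apply: adj_neq; rewrite adj_sym; assumption
  | rewrite eq_sym; assumption ].

(** * Explicit copies of the small graphs *)

Section Maps.
Variable G : sgraph.
Implicit Types (a b c d x y z u v w : G).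

Definition diamond_map a b c d (i : diamond) : G := match i with
  | inl i => nth a [:: a; b] i | inr (inl _) => c | inr (inr _) => d end.

Lemma embedding_diamond a b c d : a -- b -> a -- c -> a -- d -> b -- c -> b -- d ->
  c != d -> ~~ c -- d -> embedding (diamond_map a b c d).
Proof.
move=> ab ac ad bc bd cd ncd; apply: embeddingI.
by move=> [[[|[|?]] ?]|[[[|?] ?]|[[|?] ?]]] // [[[|[|?]] ?]|[[[|?] ?]|[[|?] ?]]] //= _;
  split; edge.
Qed.

Definition C4_map a b c d (i : C4) : G := nth a [:: a; b; c; d] i.

Lemma embedding_C4 a b c d : a -- b -> b -- c -> c -- d -> d -- a ->
  a != c -> ~~ a -- c -> b != d -> ~~ b -- d -> embedding (C4_map a b c d).
Proof.
move=> ab bc cd da ac nac bd nbd; apply: embeddingI.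
by move=> [[|[|[|[|?]]]] ?] // [[|[|[|[|?]]]] ?] //= _; split; edge.
Qed.

Definition W4_map h a b c d (i : W4) : G :=
  match i with inl _ => h | inr i => C4_map a b c d i end.

Lemma embedding_W4 h a b c d : a -- b -> b -- c -> c -- d -> d -- a ->
  a != c -> ~~ a -- c -> b != d -> ~~ b -- d ->
  h -- a -> h -- b -> h -- c -> h -- d -> embedding (W4_map h a b c d).
Proof.
move=> ab bc cd da ac nac bd nbd ha hb hc hd; apply: embeddingI.
by move=> [[[|?] ?]|[[|[|[|[|?]]]] ?]] // [[[|?] ?]|[[|[|[|[|?]]]] ?]] //= _; split; edge.
Qed.

Definition F1_map y1 y2 p q c (i : F1) : G := match i with
  | inl i => nth y1 [:: y1; y2] i
  | inr (inl i) => nth p [:: p; q] i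
  | inr (inr _) => c end.

Lemma embedding_F1 y1 y2 p q c : y1 -- y2 -> p -- q ->
  y1 -- p -> y1 -- q -> y1 -- c -> y2 -- p -> y2 -- q -> y2 -- c ->
  p != c -> ~~ p -- c -> q != c -> ~~ q -- c -> embedding (F1_map y1 y2 p q c).
Proof.
move=> *; apply: embeddingI.
by move=> [[[|[|?]] ?]|[[[|[|?]] ?]|[[|?] ?]]] //
  [[[|[|?]] ?]|[[[|[|?]] ?]|[[|?] ?]]] //= _; split; edge.
Qed.

Definition K3_map a b c (i : K 3) : G := nth a [:: a; b; c] i.

Lemma embedding_K3 a b c : a -- b -> b -- c -> a -- c -> embedding (K3_map a b c).
Proof.
move=> *; apply: embeddingI.
by move=> [[|[|[|?]]] ?] // [[|[|[|?]]] ?] //= _; split; edge.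
Qed.

Definition B1_map p q c u v (i : B1) : G := match i with
  | inl (inl i) => nth p [:: p; q] i | inl (inr _) => c
  | inr (inl _) => u | inr (inr _) => v end.

Lemma embedding_B1 p q c u v : p -- q -> p != c -> ~~ p -- c -> q != c -> ~~ q -- c ->
  u != v -> ~~ u -- v -> u -- p -> u -- q -> u -- c -> v -- p -> v -- q -> v -- c ->
  embedding (B1_map p q c u v).
Proof.
move=> *; apply: embeddingI.
by move=> [[[[|[|?]] ?]|[[|?] ?]]|[[[|?] ?]|[[|?] ?]]] //
  [[[[|[|?]] ?]|[[|?] ?]]|[[[|?] ?]|[[|?] ?]]] //= _; split; edge.
Qed.

Definition B2_map a b c d e f (i : B2) : G := nth a [:: a; b; c; d; e; f] i.

Lemma embedding_B2 a b c d e f :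
  a -- b -> b -- c -> c -- d -> d -- e -> e -- f -> f -- a -> a -- d -> c -- f ->
  a != c -> ~~ a -- c -> a != e -> ~~ a -- e -> b != d -> ~~ b -- d ->
  b != e -> ~~ b -- e -> b != f -> ~~ b -- f -> c != e -> ~~ c -- e ->
  d != f -> ~~ d -- f -> embedding (B2_map a b c d e f).
Proof.
move=> *; apply: embeddingI.
by move=> [[|[|[|[|[|[|?]]]]]] ?] // [[|[|[|[|[|[|?]]]]]] ?] //= _; split; edge.
Qed.

Definition B3_map a b c d u v (i : B3) : G := match i with
  | inl (inl (inl _)) => a | inl (inl (inr _)) => b
  | inl (inr (inl _)) => c | inl (inr (inr _)) => d
  | inr (inl _) => u | inr (inr _) => v end.

Lemma embedding_B3 a b c d u v : a != b -> ~~ a -- b -> c != d -> ~~ c -- d ->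
  u != v -> ~~ u -- v -> a -- c -> a -- d -> b -- c -> b -- d ->
  a -- u -> a -- v -> b -- u -> b -- v -> c -- u -> c -- v -> d -- u -> d -- v ->
  embedding (B3_map a b c d u v).
Proof.
move=> *; apply: embeddingI.
by move=> [[[[[|?] ?]|[[|?] ?]]|[[[|?] ?]|[[|?] ?]]]|[[[|?] ?]|[[|?] ?]]] //
  [[[[[|?] ?]|[[|?] ?]]|[[[|?] ?]|[[|?] ?]]]|[[[|?] ?]|[[|?] ?]]] //= _; split; edge.
Qed.

Definition B4_map a b c d e f (i : B4) : G := nth a [:: a; b; c; d; e; f] i.

Lemma embedding_B4 a b c d e f :
  a -- b -> b -- c -> c -- d -> d -- e -> e -- f -> f -- a ->
  a -- c -> a -- d -> c -- f -> d -- f ->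
  a != e -> ~~ a -- e -> b != d -> ~~ b -- d ->
  b != e -> ~~ b -- e -> b != f -> ~~ b -- f -> c != e -> ~~ c -- e ->
  embedding (B4_map a b c d e f).
Proof.
move=> *; apply: embeddingI.
by move=> [[|[|[|[|[|[|?]]]]]] ?] // [[|[|[|[|[|[|?]]]]]] ?] //= _; split; edge.
Qed.

Definition B5_map a b c d u v (i : B5) : G := match i with
  | inl (inl i) => nth a [:: a; b] i | inl (inr i) => nth c [:: c; d] i
  | inr i => nth u [:: u; v] i end.

Lemma embedding_B5 a b c d u v : a -- b -> c -- d -> u -- v ->
  u -- a -> u -- b -> u -- c -> u -- d -> v -- a -> v -- b -> v -- c -> v -- d ->
  a != c -> ~~ a -- c -> a != d -> ~~ a -- d -> b != c -> ~~ b -- c ->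
  b != d -> ~~ b -- d -> embedding (B5_map a b c d u v).
Proof.
move=> *; apply: embeddingI.
by move=> [[[[|[|?]] ?]|[[|[|?]] ?]]|[[|[|?]] ?]] //
  [[[[|[|?]] ?]|[[|[|?]] ?]]|[[|[|?]] ?]] //= _; split; edge.
Qed.

Definition B6_map a b c d u v (i : B6) : G := match i with
  | inl (inl i) => nth a [:: a; b; c] i | inl (inr _) => d
  | inr i => nth u [:: u; v] i end.

Lemma embedding_B6 a b c d u v : a -- b -> b -- c -> a -- c -> u -- v ->
  u -- a -> u -- b -> u -- c -> u -- d -> v -- a -> v -- b -> v -- c -> v -- d ->
  a != d -> ~~ a -- d -> b != d -> ~~ b -- d -> c != d -> ~~ c -- d ->
  embedding (B6_map a b c d u v).
Proof.
move=> *; apply: embeddingI.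
by move=> [[[[|[|[|?]]] ?]|[[|?] ?]]|[[|[|?]] ?]] //
  [[[[|[|[|?]]] ?]|[[|?] ?]]|[[|[|?]] ?]] //= _; split; edge.
Qed.

End Maps.

Lemma noncut_diamond_deg2 : noncut diamond_deg2.
Proof.
apply: (@noncut_universal _ _ diamond_deg3) => //.
by move=> [[[|[|?]] ?]|[[[|?] ?]|[[|?] ?]]].
Qed.

Lemma noncut_diamond_deg3 : noncut diamond_deg3.
Proof.
apply: (@noncut_universal _ _ diamond_deg3') => //.
by move=> [[[|[|?]] ?]|[[[|?] ?]|[[|?] ?]]].
Qed.

Lemma noncut_diamond_deg3' : noncut diamond_deg3'.
Proof.
apply: (@noncut_universal _ _ diamond_deg3) => //.
by move=> [[[|[|?]] ?]|[[[|?] ?]|[[|?] ?]]].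
Qed.

Lemma noncut_F1 (u : F1) : u != F1_deg4 -> noncut u.
Proof.
move=> uF; apply: (@noncut_universal _ _ F1_deg4); first by rewrite eq_sym.
by move=> [[[|[|?]] ?]|[[[|[|?]] ?]|[[|?] ?]]].
Qed.

Lemma noncut_F1_deg4 : noncut F1_deg4.
Proof.
apply: (@noncut_universal F1 _ (inl (ord_max : 'I_2))) => //.
by move=> [[[|[|?]] ?]|[[[|[|?]] ?]|[[|?] ?]]].
Qed.

Lemma noncut_K3 (u : K 3) : noncut u.
Proof.
move=> x y xu yu; have [->|xy] := eqVneq x y; first exact: connect0.
exact: linked_adj.
Qed.

Definition C4_opp : C4 := Ordinal (isT : 2 < 4).

Lemma noncut_C4 : noncut C4_v.
Proof.
have L x : x != C4_v -> linked C4_v x C4_opp.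
  have [->|xo xv] := eqVneq x C4_opp; first by move=> _; exact: connect0.
  by apply: linked_adj => //; case: x xo xv => [[|[|[|[|?]]]] ?].
by move=> x y xu yu; apply: linked_trans (L x xu) _; rewrite linkedC L.
Qed.

Lemma noncut_W4_hub : noncut W4_hub.
Proof.
have cC : forall y, connect (@adj C4) C4_v y.
  by apply: (@noncut_connect _ _ (Ordinal (isT : 1 < 4) : C4)) => //; exact: noncut_C4.
have L x : x != W4_hub -> linked W4_hub (inr C4_v) x.
  case: x => [[[|?] ?] //|y _].
  by apply: (@connect_linked C4 W4 inr).
by move=> x y xu yu; apply: linked_trans (L y yu); rewrite linkedC L.
Qed.

(** The two graphs certifying a nonedge at [gadget_pt]; the boolean lets a family of obstructions be
    handled at once. *)
Definition gadget (b : bool) : sgraph := if b then diamond else C4.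
Definition gadget_pt (b : bool) : gadget b :=
  match b with true => diamond_deg2 | false => C4_v end.

Lemma noncut_gadget b : noncut (gadget_pt b).
Proof. by case: b; [exact: noncut_diamond_deg2 | exact: noncut_C4]. Qed.

Lemma connect_gadget b y : connect (@adj (gadget b)) (gadget_pt b) y.
Proof.
case: b y.
  by apply: (@noncut_connect _ _ diamond_deg3) => //; exact: noncut_diamond_deg2.
by apply: (@noncut_connect _ _ (Ordinal (isT : 1 < 4) : C4)) => //; exact: noncut_C4.
Qed.

(** Two common neighbours of [x] and [y] give a diamond if they are adjacent and a C_4 if not. *)
Lemma nonedge_gadget (G : sgraph) (x y : G) : no_P4 G -> nonedge x y ->
  exists b (f : gadget b -> G) z,
    [/\ embedding f, f (gadget_pt b) = x, z != gadget_pt b & f z = y].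
Proof.
move=> P4 xy; have xyI := nonedge_insep xy.
have [s [t [st xs sy xt ty]]] :=
  common_neighbours xy (fun p : seq G => nonedge_short P4 xy).
have [ys tx] : y -- s /\ t -- x by rewrite adj_sym (adj_sym t).
have nxy := nonedge_neq xy; have naxy := nonedge_adj xy.
have [st'|st'] := boolP (s -- t).
  exists true, (diamond_map s t x y), (inr (inr ord0)); split=> //.
  by apply: embedding_diamond; rewrite // adj_sym.
exists false, (C4_map x s y t), C4_opp; split=> //.
by apply: embedding_C4; rewrite // adj_sym.
Qed.

(** * Graphs with a probe labelling are free of the obstructions *)

Lemma nonedge_embedding (H G : sgraph) (f : H -> G) x y :
  embedding f -> nonedge x y -> nonedge (f x) (f y).
Proof.
move=> fE /andP[xy nxy]; rewrite /nonedge /= (proj2 fE) nxy andbT.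
exact: insep_embedding.
Qed.

Section Labelled.
Variables (G : sgraph) (N1 N2 : {set G}).
Hypothesis lab : probe_labelling N1 N2.
Implicit Types x y z w : G.

Lemma probe_labels x y : nonedge x y ->
  (x \in N1 /\ y \in N1) \/ (x \in N2 /\ y \in N2).
Proof. by case: lab => _ _; apply. Qed.

Lemma probe_indep1 x y : x \in N1 -> y \in N1 -> x -- y -> False.
Proof. by case: lab => i1 _ _; apply: independentP i1. Qed.

Lemma probe_indep2 x y : x \in N2 -> y \in N2 -> x -- y -> False.
Proof. by case: lab => _ i2 _; apply: independentP i2. Qed.

Lemma nonedge_labelled x y : nonedge x y -> x \in N1 :|: N2.
Proof. by rewrite inE => /probe_labels[[-> _]|[-> _]]; rewrite ?orbT. Qed.

(** The adjacent [p] and [q] share no label, but [c] shares one with each. *)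
Lemma nonedge2_both c p q : nonedge c p -> nonedge c q -> p -- q -> c \in N1 :&: N2.
Proof.
rewrite inE => /probe_labels[[a1 a2]|[a1 a2]] /probe_labels[[b1 b2]|[b1 b2]] pq;
  rewrite ?a1 ?b1 //.
- by case: (probe_indep1 a2 b2).
- by case: (probe_indep2 a2 b2).
Qed.

Lemma both_labelled_adj x y : x \in N1 :&: N2 -> y \in N1 :|: N2 -> x -- y -> False.
Proof.
by rewrite !inE => /andP[x1 x2] /orP[]; [apply: probe_indep1 | apply: probe_indep2].
Qed.

Lemma labelled_triangle x y z : x \in N1 :|: N2 -> y \in N1 :|: N2 ->
  z \in N1 :|: N2 -> x -- y -> y -- z -> x -- z -> False.
Proof.
rewrite !inE => /orP[] a /orP[] b /orP[] c xy yz xz;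
  by [apply: (probe_indep1 a b)|apply: (probe_indep1 a c)|apply: (probe_indep1 b c)|
      apply: (probe_indep2 a b)|apply: (probe_indep2 a c)|apply: (probe_indep2 b c)].
Qed.

(** The two nonedges must use different labels, so [h] is adjacent to both labels. This is the
    situation of the hub of [W4] and the diagonals of its rim. *)
Lemma nonedges_cross x y z w h : nonedge x y -> nonedge z w -> x -- z -> y -- w ->
  h -- x -> h -- z -> h \notin N1 :|: N2.
Proof.
move=> xy zw xz yw hx hz; apply/negP; rewrite inE.
case: (probe_labels xy) => - [a1 a2]; case: (probe_labels zw) => - [b1 b2] /orP[] c;
  by [apply: (probe_indep1 a1 b1)|apply: (probe_indep2 a1 b1)|
      apply: (probe_indep1 c a1)|apply: (probe_indep1 c b1)|
      apply: (probe_indep2 c a1)|apply: (probe_indep2 c b1)].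
Qed.

Lemma labelled_gadget b (f : gadget b -> G) : embedding f ->
  f (gadget_pt b) \in N1 :|: N2.
Proof.
case: b f => f fE.
  apply: (nonedge_labelled (y := f (inr (inr ord0)))); apply: nonedge_embedding fE _.
  exact: (@nonedge_square diamond diamond_deg3 diamond_deg3').
apply: (nonedge_labelled (y := f C4_opp)); apply: nonedge_embedding fE _.
exact: (@nonedge_square C4 (Ordinal (isT : 1 < 4)) (Ordinal (isT : 3 < 4))).
Qed.

Lemma diamond_labels (f : diamond -> G) : embedding f ->
  (f (inr (inl ord0)) \in N1 :|: N2) /\
  ~ (f diamond_deg3 \in N1 :|: N2 /\ f diamond_deg3' \in N1 :|: N2).
Proof.
move=> fE; have L : f (inr (inl ord0)) \in N1 :|: N2 by exact: (@labelled_gadget true).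
split=> // - [l1 l2].
by apply: (labelled_triangle l1 l2 L); rewrite (proj2 fE).
Qed.

Lemma F1_labels (f : F1 -> G) : embedding f ->
  [/\ f F1_deg2 \in N1 :&: N2, f F1_deg4 \notin N1 :|: N2 &
      f (inr (inl ord_max)) \in N1 :|: N2].
Proof.
move=> fE; pose q : F1 := inr (inl ord_max).
have n1 : nonedge (f F1_deg2) (f F1_deg3).
  apply: nonedge_embedding fE _.
  exact: (@nonedge_square F1 F1_deg4 (inl ord_max)).
have n2 : nonedge (f F1_deg2) (f q).
  apply: nonedge_embedding fE _.
  exact: (@nonedge_square F1 F1_deg4 (inl ord_max)).
have B : f F1_deg2 \in N1 :&: N2 by apply: (nonedge2_both n1 n2); rewrite (proj2 fE).
split=> //; last by apply: (nonedge_labelled (y := f F1_deg2)); rewrite nonedgeC.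
by apply/negP=> /(both_labelled_adj B); apply; rewrite (proj2 fE).
Qed.

Lemma W4_labels (f : W4 -> G) : embedding f -> f W4_hub \notin N1 :|: N2.
Proof.
move=> fE; pose c i (lt : i < 4) : W4 := inr (Ordinal lt : C4).
have n1 : nonedge (f (c 0 isT)) (f (c 2 isT)).
  by apply: nonedge_embedding fE _; apply: (@nonedge_square W4 (c 1 isT) (c 3 isT)).
have n2 : nonedge (f (c 1 isT)) (f (c 3 isT)).
  by apply: nonedge_embedding fE _; apply: (@nonedge_square W4 (c 0 isT) (c 2 isT)).
by apply: (nonedges_cross n1 n2); rewrite (proj2 fE).
Qed.

Lemma C4_labels (f : C4 -> G) : embedding f ->
  f (Ordinal (isT : 1 < 4)) \in N1 :|: N2.
Proof.
move=> fE; apply: (nonedge_labelled (y := f (Ordinal (isT : 3 < 4)))).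
apply: nonedge_embedding fE _.
exact: (@nonedge_square C4 C4_v C4_opp).
Qed.

Lemma labelled_no_glue (H K : sgraph) (u : H) (v : K) (f : glue u v -> G) :
  (forall g : H -> G, embedding g -> g u \in N1 :|: N2) ->
  (forall g : K -> G, embedding g -> g v \notin N1 :|: N2) -> ~ embedding f.
Proof.
move=> Hu Kv fE; have := Hu _ (embedding_comp fE (embedding_inl u v)).
apply/negP; rewrite /= -(glue_right_pt u v).
exact: (Kv _ (embedding_comp fE (embedding_glue_right u v))).
Qed.

(** The identified vertex needs both labels, yet its neighbour [w] is labelled; this excludes [G5],
    [G6] and [G7]. *)
Lemma labelled_no_glue_both (H K : sgraph) (u : H) (v w : K) (f : glue u v -> G) :
  (forall g : H -> G, embedding g -> g u \in N1 :&: N2) ->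
  v -- w -> (forall g : K -> G, embedding g -> g w \in N1 :|: N2) -> ~ embedding f.
Proof.
move=> Hu vw Kw fE; have := Hu _ (embedding_comp fE (embedding_inl u v)).
have gE := embedding_comp fE (embedding_glue_right u v).
rewrite /= -(glue_right_pt u v) => /both_labelled_adj /(_ (Kw _ gE)); apply.
by rewrite (proj2 gE).
Qed.

Lemma labelled_no_link (H K : sgraph) (u : H) (v : K) (f : link u v -> G) :
  (forall g : H -> G, embedding g -> g u \in N1 :&: N2) ->
  (forall g : K -> G, embedding g -> g v \in N1 :|: N2) -> ~ embedding f.
Proof.
move=> Hu Kv fE; have := Hu _ (embedding_comp fE (embedding_link_l u v)).
move=> /both_labelled_adj.
move=> /(_ _ (Kv _ (embedding_comp fE (embedding_link_r u v)))); apply.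
by rewrite (proj2 fE) /= !eqxx.
Qed.

Lemma labelled_no_diamond_chain b b'
  (f : diamond_chain (gadget_pt b) (gadget_pt b') -> G) : ~ embedding f.
Proof.
move=> fE; have f1 := embedding_comp fE (embedding_inl _ _).
have f2 := embedding_comp fE (embedding_glue_right _ _).
have g1 := embedding_comp f1 (embedding_inl _ _).
have g2 := embedding_comp f1 (embedding_glue_right _ _).
have := labelled_gadget f2; have := labelled_gadget g2.
have [_] := diamond_labels g1.
by rewrite /= !glue_right_pt => H a1 a2; apply: H.
Qed.

Lemma labelled_no_triangle_glue b b' b''
  (f : triangle_glue (gadget_pt b) (gadget_pt b') (gadget_pt b'') -> G) :
  ~ embedding f.
Proof.
move=> fE; have f1 := embedding_comp fE (embedding_inl _ _).
have f2 := embedding_comp fE (embedding_glue_right _ _).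
have g1 := embedding_comp f1 (embedding_inl _ _).
have g2 := embedding_comp f1 (embedding_glue_right _ _).
have h1 := embedding_comp g1 (embedding_inl _ _).
have h2 := embedding_comp g1 (embedding_glue_right _ _).
have := labelled_gadget f2; have := labelled_gadget g2; have := labelled_gadget h2.
rewrite /= !glue_right_pt => a1 a2 a3.
by apply: (labelled_triangle a1 a2 a3); rewrite (proj2 fE).
Qed.

Lemma probe_labelling_G_free : free G_list G.
Proof.
have gl b := @labelled_gadget b; have gd := gl true; have gc := gl false.
have f4 (g : F1 -> G) : embedding g -> g F1_deg4 \notin N1 :|: N2 by case/F1_labels.
have f2 (g : F1 -> G) : embedding g -> g F1_deg2 \in N1 :&: N2 by case/F1_labels.
have f3 (g : F1 -> G) : embedding g -> g (inr (inl ord_max)) \in N1 :|: N2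
  by case/F1_labels.
have d2 (g : diamond -> G) : embedding g -> g (inr (inl ord0)) \in N1 :|: N2
  by case/diamond_labels.
apply/freeP=> H; rewrite /G_list /=.
case=> [<-|]; first by move=> f; exact: labelled_no_glue gd f4.
case=> [<-|]; first by move=> f; exact: labelled_no_glue gc f4.
case=> [<-|]; first by move=> f; exact: labelled_no_glue gd W4_labels.
case=> [<-|]; first by move=> f; exact: labelled_no_glue gc W4_labels.
case=> [<-|]; first by move=> f; exact: (labelled_no_glue_both f2 _ d2).
case=> [<-|]; first by move=> f; exact: (labelled_no_glue_both f2 _ C4_labels).
case=> [<-|]; first by move=> f; exact: (labelled_no_glue_both f2 _ f3).
case=> [<-|]; first by move=> f; exact: labelled_no_link f2 gd.
case=> [<-|]; first by move=> f; exact: labelled_no_link f2 gc.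
case=> [<-|]; first exact: (@labelled_no_diamond_chain true true).
case=> [<-|]; first exact: (@labelled_no_diamond_chain false true).
case=> [<-|]; first exact: (@labelled_no_diamond_chain false false).
case=> [<-|]; first exact: (@labelled_no_triangle_glue true true true).
case=> [<-|]; first exact: (@labelled_no_triangle_glue false true true).
case=> [<-|]; first exact: (@labelled_no_triangle_glue false false true).
by case=> [<-|//]; exact: (@labelled_no_triangle_glue false false false).
Qed.

End Labelled.

(** Serves the nonedge 25 of [B2] and [B4], whose ends have no common neighbour. *)
Lemma insep_two_paths (G : sgraph) (x y a b c d : G) : x != y ->
  x -- a -> a -- b -> b -- y -> x -- c -> c -- d -> d -- y ->
  a != c -> a != d -> b != c -> b != d -> insep x y.
Proof.
move=> xy xa ab by_ xc cd dy ac ad bc bd; apply/insepP; split=> //.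
  exact: connect_trans (connect1 xa) (connect_trans (connect1 ab) (connect1 by_)).
move=> t tx ty; rewrite eq_sym in tx; rewrite eq_sym in ty.
have L u v : x -- u -> u -- v -> v -- y -> u != t -> v != t -> linked t x y.
  move=> xu uv vy ut vt; apply: (linked_trans (linked_adj xu tx ut)).
  exact: (linked_trans (linked_adj uv ut vt) (linked_adj vy vt ty)).
have [/andP[at_ bt]|] := boolP ((a != t) && (b != t)); first exact: L xa ab by_ _ _.
rewrite negb_and !negbK => abt; apply: L xc cd dy _ _;
  by case/orP: abt => /eqP<-; rewrite eq_sym.
Qed.

(** * Probe blocks exclude the graphs B_i and imply distance-heredity *)

Section Consequences.
Variable G : sgraph.

(** The nonedges of [B1] contain P_3 + K_2, those of [B2] and [B4] a P_4, of [B3] 3 K_2, of [B5] a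
    C_4 and of [B6] a claw. *)
Lemma probe_blocks_B_free : probe_blocks G -> free B_list G.
Proof.
move=> [P4 C4 claw P3K2 K222]; apply/freeP=> H; rewrite /B_list /=.
case=> [<-|].
  move=> f fE; pose p i : B1 := inl (inl i).
  pose c : B1 := inl (inr ord0); pose u : B1 := inr (inl ord0).
  pose v : B1 := inr (inr ord0).
  have n1 : nonedge (f (p ord0)) (f c).
    by apply: nonedge_embedding fE _; apply: (@nonedge_square B1 u v).
  have n2 : nonedge (f c) (f (p ord_max)).
    by apply: nonedge_embedding fE _; apply: (@nonedge_square B1 u v).
  have n3 : nonedge (f u) (f v).
    by apply: nonedge_embedding fE _; apply: (@nonedge_square B1 c (p ord0)).
  by apply: (P3K2 _ _ _ _ _ n1 n2 _ n3); rewrite (proj2 fE).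
case=> [<-|].
  move=> f fE; pose p i (lt : i < 6) : B2 := Ordinal lt.
  have n1 : nonedge (f (p 5 isT)) (f (p 1 isT)).
    by apply: nonedge_embedding fE _; apply: (@nonedge_square B2 (p 0 isT) (p 2 isT)).
  have n2 : nonedge (f (p 1 isT)) (f (p 4 isT)).
    apply: nonedge_embedding fE _; rewrite /nonedge /= andbT.
    exact: (@insep_two_paths B2 _ _ (p 0 isT) (p 5 isT) (p 2 isT) (p 3 isT)).
  have n3 : nonedge (f (p 4 isT)) (f (p 0 isT)).
    by apply: nonedge_embedding fE _; apply: (@nonedge_square B2 (p 3 isT) (p 5 isT)).
  by apply: (P4 _ _ _ _ n1 n2 n3); rewrite (proj2 fE).
case=> [<-|].
  move=> f fE; pose a : B3 := inl (inl (inl ord0)).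
  pose b : B3 := inl (inl (inr ord0)).
  pose c : B3 := inl (inr (inl ord0)); pose d : B3 := inl (inr (inr ord0)).
  pose u : B3 := inr (inl ord0); pose v : B3 := inr (inr ord0).
  have n1 : nonedge (f a) (f b).
    by apply: nonedge_embedding fE _; apply: (@nonedge_square B3 u v).
  have n2 : nonedge (f c) (f d).
    by apply: nonedge_embedding fE _; apply: (@nonedge_square B3 u v).
  have n3 : nonedge (f u) (f v).
    by apply: nonedge_embedding fE _; apply: (@nonedge_square B3 a b).
  by apply: (K222 _ _ _ _ _ _ n1 n2 n3); rewrite (proj2 fE).
case=> [<-|].
  move=> f fE; pose p i (lt : i < 6) : B4 := Ordinal lt.
  have n1 : nonedge (f (p 5 isT)) (f (p 1 isT)).
    by apply: nonedge_embedding fE _; apply: (@nonedge_square B4 (p 0 isT) (p 2 isT)).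
  have n2 : nonedge (f (p 1 isT)) (f (p 4 isT)).
    apply: nonedge_embedding fE _; rewrite /nonedge /= andbT.
    exact: (@insep_two_paths B4 _ _ (p 0 isT) (p 5 isT) (p 2 isT) (p 3 isT)).
  have n3 : nonedge (f (p 4 isT)) (f (p 0 isT)).
    by apply: nonedge_embedding fE _; apply: (@nonedge_square B4 (p 3 isT) (p 5 isT)).
  by apply: (P4 _ _ _ _ n1 n2 n3); rewrite (proj2 fE).
case=> [<-|].
  move=> f fE; pose a i : B5 := inl (inl i); pose b i : B5 := inl (inr i).
  have n i j : nonedge (f (a i)) (f (b j)).
    apply: nonedge_embedding fE _.
    exact: (@nonedge_square B5 (inr ord0) (inr ord_max)).
  have n' i j : nonedge (f (b i)) (f (a j)) by rewrite nonedgeC.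
  by apply: (C4 _ _ _ _ (n ord0 ord0) (n' ord0 ord_max) (n ord_max ord_max)
    (n' ord_max ord0)); rewrite (proj2 fE).
case=> [<-|//] f fE.
have n i : nonedge (f (inl (inr ord0) : B6)) (f (inl (inl i) : B6)).
  apply: nonedge_embedding fE _.
  exact: (@nonedge_square B6 (inr ord0) (inr ord_max)).
by apply: (claw _ _ _ _ (n K3_a) (n K3_b) (n K3_c)); rewrite (proj2 fE).
Qed.

Lemma induced_path_cat (x y : G) p1 p2 : induced_path x y (p1 ++ p2) ->
  induced_path x (last x p1) p1 /\ induced_path (last x p1) y p2.
Proof.
rewrite /induced_path /is_path cat_path -cat_cons cat_uniq last_cat.
case=> /and3P[/andP[pp1 pp2] /and3P[u1 u12 u2] ly] ind.
have Ex : x :: p1 ++ p2 = belast x p1 ++ last x p1 :: p2.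
  by rewrite -cat_rcons -lastI.
have nl k : k <= size p1 -> nth x (x :: p1 ++ p2) k = nth x (x :: p1) k.
  by move=> kp; rewrite -cat_cons nth_cat /= ltnS kp.
have nr k : k <= size p2 ->
    nth x (x :: p1 ++ p2) (size p1 + k) = nth (last x p1) (last x p1 :: p2) k.
  move=> kp; rewrite Ex nth_cat size_belast ltnNge leq_addr addKn /=.
  exact: set_nth_default.
split; split.
- by rewrite pp1 u1 eqxx.
- move=> i j /andP[ij jp]; have ip : i <= size p1 := leq_trans (ltnW ij) jp.
  rewrite -!nl //; apply: ind; rewrite ij /= size_cat.
  exact: leq_trans jp (leq_addr _ _).
- rewrite pp2 ly /= u2 !andbT; apply: contra u12 => lp2.
  by apply/hasP; exists (last x p1); rewrite // mem_last.
move=> i j /andP[ij jp]; have ip : i <= size p2 := leq_trans (ltnW ij) jp.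
rewrite -!nr // => /ind; rewrite ltn_add2l ij size_cat leq_add2l jp => /(_ isT).
by rewrite -addnS => /addnI.
Qed.

(** An induced path of length at least 3 has separable ends. Some vertex [t] separates them, so it
    lies on every path between them; cut both paths at [t] and compare the halves by induction. *)
Lemma no_P4_distance_hereditary : no_P4 G -> distance_hereditary G.
Proof.
move=> P4 x y p ip; split=> [|q iq]; first by case: ip.
have [n] := ubnP (size p); elim: n x y p q ip iq => // n IH x y p q ip iq ltn.
have := ip => - [/and3P[pp up /eqP lp] ind].
have /and3P[pq uq /eqP lq] := iq.
have [sp|sp] := leqP (size p) 2.
  case: p sp pp up lp ind {ip ltn} => [|a [|b [|//]]] //= _.
    move=> _ up E _; case: q pq uq lq {iq} => //= _ _ F.
    by move: up; rewrite E -F inE eqxx.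
  move=> /and3P[xa ab _] /and3P[]; rewrite !inE negb_or => /andP[_ xb] _ _ E ind.
  case: q pq uq lq {iq} => [_ _ F|c [|//]] /=.
    by rewrite E -F eqxx in xb.
  rewrite andbT => xc _ F.
  by have := ind 0 2 isT; rewrite /= E -F => /(_ xc).
have xy : x != y.
  apply: contraTneq up => E; case: p lp sp {ip ltn pp ind} => // a p lp _.
  by rewrite E -lp /= mem_last.
have nxy : ~~ insep x y.
  by apply/negP=> /(no_P4_short P4) /(_ ip); rewrite leqNgt sp.
have cxy : connect (@adj G) x y by apply/connectP; exists p.
have [t tx [ty ntxy]] : exists2 t, t != x & t != y /\ ~~ linked t x y.
  move: nxy; rewrite /insep /= xy cxy /= => /forallPn[t].
  by rewrite !negb_imply => /and3P[]; exists t.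
have tp : t \in x :: p.
  by apply: contraNT ntxy => tp; rewrite -lp linked_path.
have tq : t \in x :: q.
  by apply: contraNT ntxy => tq; rewrite -lq linked_path.
case/splitPl: tp ip ltn {sp pp up lp ind} => p1 p2 lp1 /induced_path_cat[].
rewrite lp1 => ip1 ip2; case/splitPl: tq iq {pq uq lq} => q1 q2 lq1.
rewrite /is_path cat_path -cat_cons cat_uniq last_cat lq1.
case/and3P=> /andP[pq1 pq2] /and3P[uq1 u12 uq2] lq.
have iq1 : is_path x t q1 by rewrite /is_path pq1 uq1 lq1 eqxx.
have iq2 : is_path t y q2.
  rewrite /is_path pq2 lq /= uq2 !andbT; apply: contra u12 => tq2.
  by apply/hasP; exists t; rewrite // -lq1 mem_last.
rewrite !size_cat ltnS => sn; apply: leq_add.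
  apply: (IH x t) => //; apply: leq_trans sn; rewrite -addn1 leq_add2l lt0n.
  case: p2 ip2 => // - [/and3P[_ _ /eqP E] _].
  by move: ty; rewrite -E eqxx.
apply: (IH t y) => //; apply: leq_trans sn; rewrite -add1n leq_add2r lt0n.
by case: p1 lp1 {ip1} => //= E; move: tx; rewrite -E eqxx.
Qed.

End Consequences.

Lemma probe_labelling_blocks (G : sgraph) (N1 N2 : {set G}) : probe_labelling N1 N2 ->
  forall B : subgraph G, block B -> two_probe_complete_graph B.
Proof.
move=> [i1 i2 H] B bB.
have iB (N : {set G}) : independent N -> @independent B [set u | val u \in N].
  move=> iN u v; rewrite !inE => uN vN; apply: contra (iN _ _ uN vN).
  by case/sub_adj_sub.
exists [set u : B | val u \in N1], [set u : B | val u \in N2].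
exists (fun u v => u != v), (@neq_sym B), (@neq_irr B); split=> //.
- exact: iB.
- exact: iB.
- by move=> u v; apply: adj_neq.
move=> u v uv nuv; rewrite !inE; apply: H; rewrite /nonedge /=.
rewrite (block_insep (proj1 bB)) ?(valP u) ?(valP v) //=.
apply: contra nuv; exact: (block_adj bB (valP u) (valP v)).
Qed.

Lemma probe_labelling_probe_blocks (G : sgraph) (N1 N2 : {set G}) :
  probe_labelling N1 N2 -> probe_blocks G.
Proof.
move=> [i1 i2 H]; apply: labelled_probe_blocks => x y xy.
by exists N1, N2; split=> // z w _ _; apply: H.
Qed.

(** * Distance-hereditary graphs *)

Section DistanceHereditary.
Variable G : sgraph.
Hypothesis dhG : distance_hereditary G.
Implicit Types a b c d x y z p q r m u v : G.

Lemma is_path2 x m z : x -- m -> m -- z -> x != z -> is_path x z [:: m; z].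
Proof.
move=> xm mz xz; rewrite /is_path /= xm mz !inE (negPf xz) (negPf (adj_neq xm)).
by rewrite (negPf (adj_neq mz)) eqxx.
Qed.

Lemma dh_induced_path x z m (s : seq G) : x -- m -> m -- z -> x != z ->
  induced_path x z s -> size s <= 2.
Proof.
by move=> xm mz xz /dhG[_ /(_ _ (is_path2 xm mz xz))].
Qed.

Lemma dh_path3 x p q z m : x -- p -> p -- q -> q -- z -> ~~ x -- q -> ~~ p -- z ->
  ~~ x -- z -> x -- m -> m -- z -> False.
Proof.
move=> xp pq qz xq pz xz xm mz.
have nxq : x != q by rewrite eq_sym; apply: neq_by_adj qz xz.
have npz : p != z by apply: (neq_by_adj (z := x)); rewrite adj_sym.
have nxz : x != z by apply: (neq_by_adj xp); rewrite adj_sym.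
suff /(dh_induced_path xm mz nxz) : induced_path x z [:: p; q; z] by [].
split.
  rewrite /is_path /= xp pq qz !inE !negb_or nxq nxz npz eqxx.
  by rewrite (adj_neq xp) (adj_neq pq) (adj_neq qz).
move=> [|[|[|i]]] [|[|[|[|j]]]] /andP[] //= _ _;
  by rewrite ?(negPf xq) ?(negPf xz) ?(negPf pz).
Qed.

Lemma dh_path4 x p q r z m : x -- p -> p -- q -> q -- r -> r -- z ->
  ~~ x -- q -> ~~ x -- r -> ~~ x -- z -> ~~ p -- r -> ~~ p -- z -> ~~ q -- z ->
  x -- m -> m -- z -> False.
Proof.
move=> xp pq qr rz xq xr xz pr pz qz xm mz.
have nxq : x != q by rewrite eq_sym; apply: neq_by_adj qr xr.
have nxr : x != r by rewrite eq_sym; apply: neq_by_adj rz xz.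
have npr : p != r by rewrite eq_sym; apply: neq_by_adj rz pz.
have nxz : x != z by apply: (neq_by_adj xp); rewrite adj_sym.
have npz : p != z by apply: (neq_by_adj (z := x)); rewrite adj_sym.
have nqz : q != z by apply: (neq_by_adj (z := p)); rewrite adj_sym.
suff /(dh_induced_path xm mz nxz) : induced_path x z [:: p; q; r; z] by [].
split.
  rewrite /is_path /= xp pq qr rz !inE !negb_or nxq nxr nxz npr npz nqz eqxx.
  by rewrite (adj_neq xp) (adj_neq pq) (adj_neq qr) (adj_neq rz).
move=> [|[|[|[|i]]]] [|[|[|[|[|j]]]]] /andP[] //= _ _;
  by rewrite ?(negPf xq) ?(negPf xr) ?(negPf xz) ?(negPf pr) ?(negPf pz) ?(negPf qz).
Qed.

Hypothesis B_freeG : free B_list G.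

Let notB H : List.In H B_list -> forall f : H -> G, ~ embedding f.
Proof. by move: H; apply/freeP. Qed.

Let notB1 (f : B1 -> G) : ~ embedding f.
Proof. by apply: notB; left. Qed.
Let notB2 (f : B2 -> G) : ~ embedding f.
Proof. by apply: notB; right; left. Qed.
Let notB3 (f : B3 -> G) : ~ embedding f.
Proof. by apply: notB; do 2!right; left. Qed.
Let notB4 (f : B4 -> G) : ~ embedding f.
Proof. by apply: notB; do 3!right; left. Qed.
Let notB5 (f : B5 -> G) : ~ embedding f.
Proof. by apply: notB; do 4!right; left. Qed.
Let notB6 (f : B6 -> G) : ~ embedding f.
Proof. by apply: notB; do 5!right; left. Qed.

(** [b] does not separate [a] from [c], and an induced path avoiding [b] has length 2, as [a b c] is
    a path. *)
Lemma dh_other_neighbour a b c : nonedge a c -> a -- b -> b -- c ->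
  exists b', [/\ b' != b, a -- b' & b' -- c].
Proof.
move=> ac ab bc; apply: (common_neighbour_avoid ac (adj_neq ab)).
  by rewrite eq_sym adj_neq.
by move=> s; apply: (dh_induced_path ab bc (nonedge_neq ac)).
Qed.

Lemma dh_P3K2 : no_P3K2 G.
Proof.
move=> p c q u v pc cq pq uv up uc uq vp vc vq.
apply: (@notB1 (B1_map p q c u v)); apply: embedding_B1 => //;
  by [apply: nonedge_neq | apply: nonedge_adj | rewrite nonedge_neq // nonedgeC
     | rewrite nonedge_adj // nonedgeC].
Qed.

Lemma dh_3K2 : no_3K2 G.
Proof.
move=> a b c d u v ab cd uv *.
apply: (@notB3 (B3_map a b c d u v)); apply: embedding_B3 => //;
  by [apply: nonedge_neq | apply: nonedge_adj].
Qed.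

(** The induced path [a b c d] is enlarged by second common neighbours [b'] of [a], [c] and [c'] of
    [b], [d]. The three undecided adjacencies [bb'], [cc'], [b'c'] then give [B4], [B1], [B2], or a
    long induced path whose ends have a common neighbour. *)
Lemma dh_P4 : no_P4 G.
Proof.
(* P_4 is self-complementary: on the same vertices, a b c d is an induced path of G. *)
suff P a b c d : nonedge a c -> nonedge a d -> nonedge b d ->
    a -- b -> b -- c -> c -- d -> False.
  move=> p q r s pq qr rs pr qs ps; apply: (P q s p r) => //.
  - by rewrite nonedgeC.
  - by rewrite nonedgeC.
  - by rewrite adj_sym.
move=> ac ad bd ab bc cd.
have [b' [b'b ab' b'c]] := dh_other_neighbour ac ab bc.
have [c' [c'c bc' c'd]] := dh_other_neighbour bd bc cd.
have [nac nad nbd] : [/\ a != c, a != d & b != d] by split; exact: nonedge_neq.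
have [Nac Nad Nbd] : [/\ ~~ a -- c, ~~ a -- d & ~~ b -- d].
  by split; exact: nonedge_adj.
(* A common neighbour of [a] and [d] would make [a b c d] an induced path that is not shortest. *)
have Nb'd : ~~ b' -- d.
  by apply/negP=> b'd; apply: (dh_path3 ab bc cd Nac Nbd Nad ab' b'd).
have Nac' : ~~ a -- c'.
  by apply/negP=> ac'; apply: (dh_path3 ab bc cd Nac Nbd Nad ac' c'd).
have [Nda Ndb' Nc'a] : [/\ ~~ d -- a, ~~ d -- b' & ~~ c' -- a].
  by rewrite ![d -- _]adj_sym (adj_sym c').
have [ba cb dc b'a] : [/\ b -- a, c -- b, d -- c & b' -- a].
  by rewrite (adj_sym b) (adj_sym c) (adj_sym d) (adj_sym b').
have [cb' c'b dc'] : [/\ c -- b', c' -- b & d -- c'].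
  by rewrite (adj_sym c) (adj_sym c') (adj_sym d).
have nb'd : b' != d by apply: (neq_by_adj b'a); rewrite adj_sym.
have nac' : a != c' by rewrite eq_sym; apply: (neq_by_adj c'd).
have [bb'|Nbb'] := boolP (b -- b'); have [cc'|Ncc'] := boolP (c -- c');
  have [b'c'|Nb'c'] := boolP (b' -- c').
- by apply: (@notB4 (B4_map b a b' c d c')); apply: embedding_B4 ;
    edge.
- by apply: (dh_path3 (_ : b' -- b) bc' c'd _ _ _ b'c cd); edge.
- by apply: (@notB1 (B1_map b b' d c c')); apply: embedding_B1 ;
    edge.
- by apply: (dh_path3 c'd dc cb' _ _ _ c'b bb'); edge.
- by apply: (@notB1 (B1_map c c' a b b')); apply: embedding_B1 ;
    edge.
- by apply: (dh_path3 b'a ab bc' _ _ _ b'c cc'); edge.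
- by apply: (@notB2 (B2_map b a b' c d c')); apply: embedding_B2 ;
    edge.
by apply: (dh_path4 b'a ab bc' c'd _ _ _ _ _ _ b'c cd); edge.
Qed.

Lemma dh_nonedge_neighbours x y : nonedge x y ->
  exists s t, [/\ s != t, x -- s, s -- y, x -- t & t -- y].
Proof.
by move=> xy; apply: (common_neighbours xy) => p; exact: (nonedge_short dh_P4 xy).
Qed.

(** Two common neighbours of [c] and [x] are also adjacent to [y] and [z], by [neighbour_adj]. They
    complete the claw to [B6] if adjacent, and otherwise form [B1] with [x], [y], [c]. *)
Lemma dh_claw : no_claw G.
Proof.
move=> c x y z cx cy cz xy yz xz.
have [u [v [uv cu ux cv vx]]] := dh_nonedge_neighbours cx.
have uy := neighbour_adj dh_P4 cx cy xy cu ux.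
have uz := neighbour_adj dh_P4 cx cz xz cu ux.
have vy := neighbour_adj dh_P4 cx cy xy cv vx.
have vz := neighbour_adj dh_P4 cx cz xz cv vx.
have [uc vc] : u -- c /\ v -- c by rewrite !(adj_sym _ c).
have [xc yc zc] : [/\ nonedge x c, nonedge y c & nonedge z c].
  by rewrite !(nonedgeC _ c).
have [uv'|Nuv] := boolP (u -- v).
  by apply: (@notB6 (B6_map x y z c u v)); apply: embedding_B6 => //;
    (exact: nonedge_neq || exact: nonedge_adj).
by apply: (@notB1 (B1_map x y c u v)); apply: embedding_B1 => //;
  (exact: nonedge_neq || exact: nonedge_adj).
Qed.

Lemma dh_C4 : no_C4 G.
Proof.
move=> x z y w xz zy yw wx xy zw.
have zx : nonedge z x by rewrite nonedgeC.
have yz : nonedge y z by rewrite nonedgeC.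
have xw : nonedge x w by rewrite nonedgeC.
have [u [v [uv zu ux zv vx]]] := dh_nonedge_neighbours zx.
have [xu uz xv vz] : [/\ x -- u, u -- z, x -- v & v -- z].
  by rewrite !(adj_sym x) !(adj_sym _ z).
have uy := neighbour_adj dh_P4 zx zy xy zu ux.
have uw := neighbour_adj dh_P4 xz xw zw xu uz.
have vy := neighbour_adj dh_P4 zx zy xy zv vx.
have vw := neighbour_adj dh_P4 xz xw zw xv vz.
have [uv'|Nuv] := boolP (u -- v).
  by apply: (@notB5 (B5_map x y z w u v)); apply: embedding_B5 => //;
    (exact: nonedge_neq || exact: nonedge_adj).
by apply: (@notB1 (B1_map x y z u v)); apply: embedding_B1 => //;
  (exact: nonedge_neq || exact: nonedge_adj).
Qed.

Lemma dh_probe_blocks : probe_blocks G.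
Proof.
split; [exact: dh_P4 | exact: dh_C4 | exact: dh_claw | exact: dh_P3K2 | exact: dh_3K2].
Qed.

End DistanceHereditary.

(** * Constructing a probe labelling *)

Section Hanging.
Variable G : sgraph.
Hypothesis P4G : no_P4 G.
Implicit Types (a b c d p q s t u v w x y z : G) (i j k : bool).

(* The gadget, a diamond or a C_4, certifies that x needs a label because of a block
   other than that of x and y. *)
Definition hangs x y i := exists (f : gadget i -> G) (z : gadget i),
  [/\ embedding f, f (gadget_pt i) = x, z != gadget_pt i & ~~ linked x y (f z)].

Lemma nonedge_hangs x y w : nonedge x w -> ~~ linked x y w -> exists i, hangs x y i.
Proof.
move=> xw nl; have [i [f [z [fE fx zp fz]]]] := nonedge_gadget P4G xw.
by exists i, f, z; split; rewrite // fz.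
Qed.

Lemma hangs_linked x y z i : linked x y z -> hangs x z i -> hangs x y i.
Proof.
move=> xyz [f [w [fE fx wp nl]]]; exists f, w; split=> //.
by apply: contra nl; apply: linked_trans; rewrite linkedC.
Qed.

Lemma diamond_chain_embedding a b s t i j : a -- b -> a -- s -> a -- t -> b -- s ->
  b -- t -> s != t -> ~~ s -- t -> hangs a b i -> hangs b a j ->
  exists f : diamond_chain (gadget_pt i) (gadget_pt j) -> G, embedding f.
Proof.
move=> ab as_ at_ bs bt st nst [f [z [fE fa zi nf]]] [g [w [gE gb wj ng]]].
have mE := embedding_diamond ab as_ at_ bs bt st nst.
have hE : embedding (@glue_map _ _ diamond_deg3 (gadget_pt i) _ (diamond_map a b s t) f).
  apply: (embedding_glue (x0 := diamond_deg3') (y0 := z)) => //.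
  - exact: noncut_diamond_deg3.
  - exact: noncut_gadget.
exists (glue_map (glue_map (diamond_map a b s t) f) g).
apply: (embedding_glue (x0 := (inl diamond_deg3 : glue diamond_deg3 (gadget_pt i)))
  (y0 := w) hE gE) => //.
- apply: noncut_glue => //; [exact: noncut_diamond_deg3' | exact: connect_gadget].
- exact: noncut_gadget.
Qed.

Lemma triangle_glue_embedding a b c i j k : a -- b -> b -- c -> a -- c ->
  hangs a b i -> hangs b a j -> hangs c a k ->
  exists f : triangle_glue (gadget_pt i) (gadget_pt j) (gadget_pt k) -> G, embedding f.
Proof.
move=> ab bc ac [f [x [fE fa xi nf]]] [g [y [gE gb yj ng]]] [h [z [hE hc zk nh]]].
have tE := embedding_K3 ab bc ac.
have E1 : embedding (@glue_map _ _ K3_a (gadget_pt i) _ (K3_map a b c) f).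
  apply: (embedding_glue (x0 := K3_b) (y0 := x)) => //.
  - exact: noncut_K3.
  - exact: noncut_gadget.
have E2 : embedding (@glue_map _ _ (inl K3_b : glue K3_a (gadget_pt i)) (gadget_pt j) _
    (@glue_map _ _ K3_a (gadget_pt i) _ (K3_map a b c) f) g).
  apply: (embedding_glue (x0 := (inl K3_a : glue K3_a (gadget_pt i))) (y0 := y)) => //.
  - by apply: noncut_glue => //; [exact: noncut_K3 | exact: connect_gadget].
  - exact: noncut_gadget.
exists (glue_map (glue_map (glue_map (K3_map a b c) f) g) h).
apply: (embedding_glue
  (x0 := (inl (inl K3_a) : glue (inl K3_b : glue K3_a (gadget_pt i)) (gadget_pt j)))
  (y0 := z) E2 hE) => //.
- apply: noncut_glue => //; last exact: connect_gadget.
  by apply: noncut_glue => //; [exact: noncut_K3 | exact: connect_gadget].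
- exact: noncut_gadget.
Qed.

(** The degree-4 vertices are [y] and a second common neighbour [y'] of [c] and [p], both adjacent
    to [q] by [neighbour_adj]. They are adjacent, for otherwise [y y'] and [p c q] would form P_3 +
    K_2. *)
Lemma F1_of_nonedges c p q y : no_P3K2 G -> nonedge c p -> nonedge c q -> p -- q ->
  y -- c -> y -- p -> exists f : F1 -> G,
    [/\ embedding f, f F1_deg4 = y, f F1_deg2 = c, f F1_deg3 = p &
        f (inr (inl ord_max)) = q].
Proof.
move=> P3K2 cp cq pq yc yp; have cy : c -- y by rewrite adj_sym.
have yq : y -- q := neighbour_adj P4G cp cq pq cy yp.
have [|y' [y'y cy' y'p]] := common_neighbour_avoid cp (adj_neq cy) _
    (fun s : seq G => nonedge_short P4G cp).
  by rewrite eq_sym adj_neq.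
have y'q : y' -- q := neighbour_adj P4G cp cq pq cy' y'p.
have y'c : y' -- c by rewrite adj_sym.
have pc : nonedge p c by rewrite nonedgeC.
have qc : nonedge q c by rewrite nonedgeC.
have [yy'|nyy'] := boolP (y -- y').
  exists (F1_map y y' p q c); split=> //.
  by apply: embedding_F1 => //; (exact: nonedge_neq || exact: nonedge_adj).
have n : nonedge y y'.
  by apply: (nonedge_square (s := c) (t := p)); rewrite 1?eq_sym // nonedge_neq.
by case: (P3K2 _ _ _ _ _ pc cq pq n).
Qed.

End Hanging.

(** * Conflicting demands yield an obstruction *)

Section Construction.
Variable G : sgraph.
Hypothesis pbG : probe_blocks G.
Hypothesis freeG : free G_list G.
Implicit Types (a b c d p q s t u v w x y z : G) (i j k : bool).

Let P4 := pb_P4 pbG.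
Let P3K2 := pb_P3K2 pbG.

Let notG H : List.In H G_list -> forall f : H -> G, ~ embedding f.
Proof. by move: H; apply/freeP. Qed.

Lemma not_gadget_F1 i (f : glue (gadget_pt i) F1_deg4 -> G) : ~ embedding f.
Proof. by case: i f; apply: notG; [left | right; left]. Qed.

Lemma not_gadget_W4 i (f : glue (gadget_pt i) W4_hub -> G) : ~ embedding f.
Proof. by case: i f; apply: notG; [do 2!right; left | do 3!right; left]. Qed.

Lemma not_F1_link i (f : link F1_deg2 (gadget_pt i) -> G) : ~ embedding f.
Proof. by case: i f; apply: notG; [do 7!right; left | do 8!right; left]. Qed.

(** Each obstruction is listed in one order only, a C_4 ([false]) before a diamond ([true]); its
    users sort their gadgets. *)
Lemma not_diamond_chain i j (f : diamond_chain (gadget_pt i) (gadget_pt j) -> G) :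
  i <= j -> ~ embedding f.
Proof.
by case: i f; case: j => // f _; apply: notG;
  [do 9!right; left | do 10!right; left | do 11!right; left].
Qed.

Lemma not_triangle_glue i j k
  (f : triangle_glue (gadget_pt i) (gadget_pt j) (gadget_pt k) -> G) :
  i <= j -> j <= k -> ~ embedding f.
Proof.
by case: i f; case: j; case: k => // f _ _; apply: notG;
  [do 12!right; left | do 13!right; left | do 14!right; left | do 15!right; left].
Qed.

Lemma no_diamond_chain a b s t a' b' : a -- b -> a -- s -> a -- t -> b -- s ->
  b -- t -> s != t -> ~~ s -- t -> nonedge a a' -> ~~ linked a b a' ->
  nonedge b b' -> ~~ linked b a b' -> False.
Proof.
move=> ab as_ at_ bs bt st nst aa naa bb nbb; have ba : b -- a by rewrite adj_sym.
have [i hi] := nonedge_hangs P4 aa naa; have [j hj] := nonedge_hangs P4 bb nbb.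
have /orP[ij|ji] := leq_total i j.
  have [f] := diamond_chain_embedding ab as_ at_ bs bt st nst hi hj.
  exact: not_diamond_chain.
have [f] := diamond_chain_embedding ba bs bt as_ at_ st nst hj hi.
exact: not_diamond_chain.
Qed.

Lemma no_triangle a b c a' b' c' : a -- b -> b -- c -> a -- c ->
  nonedge a a' -> ~~ linked a b a' -> nonedge b b' -> ~~ linked b a b' ->
  nonedge c c' -> ~~ linked c a c' -> False.
Proof.
have key x y z i j k : x -- y -> y -- z -> x -- z -> hangs x y i -> hangs y x j ->
    hangs z x k -> i <= j -> j <= k -> False.
  move=> xy yz xz hi hj hk ij jk.
  have [f] := triangle_glue_embedding xy yz xz hi hj hk; exact: not_triangle_glue.
move=> ab bc ac aa naa bb nbb cc ncc.
have [i hi] := nonedge_hangs P4 aa naa; have [j hj] := nonedge_hangs P4 bb nbb.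
have [k hk] := nonedge_hangs P4 cc ncc.
have [ba cb ca] : [/\ b -- a, c -- b & c -- a] by rewrite (adj_sym b) !(adj_sym c).
(* The edge [yz] avoids [x], so it does not matter which other corner of the triangle is named. *)
have turn x y z l : x -- y -> y -- z -> x -- z -> hangs x y l -> hangs x z l.
  move=> xy yz xz; apply: hangs_linked; rewrite linkedC.
  by apply: linked_adj => //; rewrite eq_sym adj_neq.
have hi' := turn _ _ _ _ ab bc ac hi; have hj' := turn _ _ _ _ ba ac bc hj.
have hk' := turn _ _ _ _ ca ab cb hk.
have /orP[ij|ij] := leq_total i j; have /orP[jk|jk] := leq_total j k;
  have /orP[ik|ik] := leq_total i k.
- exact: (key a b c i j k).
- exact: (key a b c i j k).
- exact: (key a c b i k j).
- exact: (key c a b k i j).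
- exact: (key b a c j i k).
- exact: (key b c a j k i).
- by apply: (key c b a k j i).
- exact: (key c b a k j i).
Qed.

Lemma no_far_F1 (f : F1 -> G) y w : embedding f -> f F1_deg4 = y -> nonedge y w ->
  ~~ linked y (f F1_deg2) w -> False.
Proof.
move=> fE fy yw nl; have [i [g [z [gE gy zi nz]]]] := nonedge_hangs P4 yw nl.
have E : embedding (@glue_map _ _ (gadget_pt i) F1_deg4 _ g f).
  apply: (embedding_glue (x0 := z) (y0 := F1_deg2)) => //.
  - by rewrite gy fy.
  - exact: noncut_gadget.
  - exact: noncut_F1_deg4.
  - by rewrite gy linkedC.
exact: not_gadget_F1 E.
Qed.

Lemma no_far_W4 y a b c d w : a -- b -> b -- c -> c -- d -> d -- a ->
  a != c -> ~~ a -- c -> b != d -> ~~ b -- d ->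
  y -- a -> y -- b -> y -- c -> y -- d -> nonedge y w -> ~~ linked y a w -> False.
Proof.
move=> ab bc cd da ac nac bd nbd ya yb yc yd yw nl.
have fE := embedding_W4 ab bc cd da ac nac bd nbd ya yb yc yd.
have [i [g [z [gE gy zi nz]]]] := nonedge_hangs P4 yw nl.
have E : embedding (@glue_map _ _ (gadget_pt i) W4_hub _ g (W4_map y a b c d)).
  apply: (embedding_glue (x0 := z) (y0 := (inr C4_v : W4))) => //.
  - exact: noncut_gadget.
  - exact: noncut_W4_hub.
  - by rewrite gy linkedC.
exact: not_gadget_W4 E.
Qed.

Lemma no_F1_glue (H : sgraph) (v0 y0 : H) (f : F1 -> G) (g : H -> G) :
  (forall h : glue F1_deg2 v0 -> G, ~ embedding h) ->
  noncut v0 -> y0 != v0 -> embedding f -> embedding g -> f F1_deg2 = g v0 ->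
  ~~ linked (g v0) (g y0) (f F1_deg3) -> False.
Proof.
move=> nh nv yv fE gE E nl; case: (nh (glue_map f g)).
apply: (embedding_glue (x0 := F1_deg3) (y0 := y0)) => //.
- exact: noncut_F1.
- by rewrite E linkedC.
Qed.

Definition demanded x := [exists y, nonedge x y].
Definition doubly_demanded x :=
  [exists y, [exists z, [&& nonedge x y, nonedge x z & y -- z]]].

Lemma demandedP x : reflect (exists y, nonedge x y) (demanded x).
Proof. exact: existsP. Qed.

Lemma doubly_demandedP x :
  reflect (exists y z, [/\ nonedge x y, nonedge x z & y -- z]) (doubly_demanded x).
Proof.
apply: (iffP existsP) => [[y /existsP[z /and3P[]]]|[y [z [xy xz yz]]]].
  by exists y, z.
by exists y; apply/existsP; exists z; rewrite xy xz.
Qed.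

(* The F_1 given by the two nonedges at v and the gadget given by the nonedge at u
   form one of G_1, G_2, G_5, ..., G_9, depending on which blocks they lie in. *)
Lemma doubly_demanded_adj v u : v -- u -> doubly_demanded v -> ~~ demanded u.
Proof.
move=> vu /doubly_demandedP[p [q [vp vq pq]]]; apply/demandedP=> - [w uw].
have uv : u -- v by rewrite adj_sym.
have pv : nonedge p v by rewrite nonedgeC.
have wu : nonedge w u by rewrite nonedgeC.
have nuv : u != v by exact: adj_neq.
have nvw : v != w by apply: contraTneq uv => ->; exact: nonedge_adj.
have [y [_ [_ vy yp _ _]]] :=
  common_neighbours vp (fun s : seq G => nonedge_short P4 vp).
have yv : y -- v by rewrite adj_sym.
have [f [fE fy fv fp fq]] := F1_of_nonedges P4 P3K2 vp vq pq yv yp.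
have vuI := adj_insep vu; have uvI := adj_insep uv.
(* First, [u] lies in the block of [v], [p], [q]. It is then adjacent to [p] and [q] and is a
   degree-4 vertex of an F_1; if [w] lies beyond [u], this gives [G1] or [G2]. *)
have [vup|vup] := boolP (linked v u p).
  have nup : u != p by apply: contraTneq vu => ->; exact: nonedge_adj.
  have nuq : u != q by apply: contraTneq vu => ->; exact: nonedge_adj.
  have upI := linked_insep vuI (nonedge_insep vp) vup nup.
  have vuq : linked v u q.
    apply: linked_trans vup _; apply: linked_adj => //; rewrite eq_sym;
    exact: nonedge_neq.
  have uqI := linked_insep vuI (nonedge_insep vq) vuq nuq.
  have up : u -- p.
    case: (insep_cases upI) => // up; exfalso; case: (insep_cases uqI) => uq.
      exact: (P4 up pv vq).
    by apply: (pb_C4 pbG up pv vq) => //; rewrite nonedgeC.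
  have uq : u -- q := neighbour_adj P4 vp vq pq vu up.
  have [g [gE gu gv _ _]] := F1_of_nonedges P4 P3K2 vp vq pq uv up.
  have [uvw|uvw] := boolP (linked u v w); last first.
    by apply: (no_far_F1 gE gu uw); rewrite gv.
  have vwI := linked_insep uvI (nonedge_insep uw) uvw nvw.
  have vpI := nonedge_insep vp.
  have uD : u \in blk v p by apply: mem_blk.
  have vD : v \in blk v p by exact: blk_l.
  have wD : w \in blk v p.
    apply: (blk_max vpI uD vD nuv); last by rewrite insepC.
    exact: nonedge_insep.
  have qD : q \in blk v p.
    apply: mem_blk; last by rewrite insepC adj_insep.
    by rewrite insepC nonedge_insep.
  (* The closed neighbourhoods of [p] and [q] would cover the nonedge [uw], but [u] is adjacent to
     both [p] and [q]. *)
  case: (close_cover pbG vpI (blk_r vpI) vD qD pv vq pq uD wD uw) =>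
    - [/closeP[E|E] _].
  - by rewrite E eqxx in nup.
  - by move: (nonedge_adj E); rewrite adj_sym up.
  - by rewrite E eqxx in nuq.
  - by move: (nonedge_adj E); rewrite adj_sym uq.
(* Now [v] separates [u] from the rest of the F_1. If [u] separates [v] from [w], the gadget at [u]
   is joined to the F_1 by the edge [vu]: [G8] or [G9]. *)
have [uvw|uvw] := boolP (linked u v w); last first.
  have [i [g [z [gE gu zi nz]]]] := nonedge_hangs P4 uw uvw.
  apply: (@not_F1_link i (link_map f g)).
  apply: (embedding_link (x0 := F1_deg3) (y0 := z)) => //.
  - by rewrite fv gu.
  - exact: noncut_F1.
  - exact: noncut_gadget.
  - exact: connect_gadget.
  - by rewrite fv fp gu linkedC.
  - by rewrite fv gu.
have vwI := linked_insep uvI (nonedge_insep uw) uvw nvw.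
(* Otherwise [u], [v], [w] share a block. If [vw] is a nonedge, then [w] is doubly demanded by [v]
   and [u], and [v] has degree 3 in its F_1: [G7]. *)
case: (insep_cases vwI) => vw; last first.
  have wv : nonedge w v by rewrite nonedgeC.
  have [y' [_ [_ wy' y'v _ _]]] :=
    common_neighbours wv (fun s : seq G => nonedge_short P4 wv).
  have y'w : y' -- w by rewrite adj_sym.
  have [g [gE _ _ gv gu]] := F1_of_nonedges P4 P3K2 wv wu vu y'w y'v.
  apply: (@no_F1_glue F1 F1_deg3 (inr (inl ord_max)) f g); rewrite ?gv ?gu ?fp //.
  - by apply: notG; do 6!right; left.
  - exact: noncut_F1.
have wv : w != v by rewrite eq_sym.
(* If [vw] is an edge, [v] and a second common neighbour [s] of [u], [w] form a diamond with [v] of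
   degree 3 ([G5]), or a C_4 ([G6]). *)
have [s [sv us sw]] := common_neighbour_avoid uw nuv wv
    (fun s : seq G => nonedge_short P4 uw).
have su : s -- u by rewrite adj_sym.
have [nuw nauw] := (nonedge_neq uw, nonedge_adj uw).
have [vs|nvs] := boolP (v -- s).
  apply: (@no_F1_glue diamond diamond_deg3 (inr (inl ord0)) f (diamond_map v s u w)) => //.
  - by apply: notG; do 4!right; left.
  - exact: noncut_diamond_deg3.
  - by apply: embedding_diamond; edge.
  - by rewrite /= fp.
apply: (@no_F1_glue C4 C4_v (Ordinal (isT : 1 < 4)) f (C4_map v u s w)) => //.
- by apply: notG; do 5!right; left.
- exact: noncut_C4.
- by apply: embedding_C4; edge.
- by rewrite /= fp.
Qed.

End Construction.

(** * Signs on each block and the labelling they determine *)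

Section Signs.
Variable G : sgraph.
Hypothesis pbG : probe_blocks G.
Hypothesis freeG : free G_list G.
Implicit Types (a b c d p q s t u v w x y z : G).

Let P4 := pb_P4 pbG.
Let P3K2 := pb_P3K2 pbG.

(** Membership in [F] is the sign. A doubly demanded vertex gets both labels, so its nonedges impose
    nothing on the signs. *)
Definition good_signs (D F : {set G}) := [forall z in D, forall w in D,
  (nonedge z w && ~~ doubly_demanded z && ~~ doubly_demanded w ==>
     ((z \in F) == (w \in F))) &&
  (z -- w && demanded z && demanded w ==> ((z \in F) != (w \in F)))].

Section Block.
Variables x0 y0 : G.
Hypothesis xy0 : insep x0 y0.
Local Notation D := (blk x0 y0).

Lemma outside_blk a b w : a \in D -> b \in D -> a != b -> nonedge a w -> w \notin D ->
  ~~ linked a b w.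
Proof.
move=> aD bD ab aw wD; apply: contra (wD) => abw.
have bw : b != w by apply: contraNneq wD => <-.
have awI := nonedge_insep aw.
have bwI := linked_insep (blk_insep xy0 aD bD ab) awI abw bw.
by apply: (blk_max xy0 aD bD ab); rewrite insepC.
Qed.

(** All demands come from other blocks, and three demanded vertices would give one of [G13] to
    [G16]. With at most two, it suffices to single one out. *)
Lemma complete_blk_signs : (forall z w, z \in D -> w \in D -> ~~ nonedge z w) ->
  exists F, good_signs D F.
Proof.
move=> cD; pose F := if [pick z in D | demanded z] is Some z then [set z] else set0.
exists F; apply/forall_inP=> z zD; apply/forall_inP=> w wD.
rewrite (negPf (cD z w zD wD)) /=; apply/implyP=> /andP[/andP[zw dz] dw].
have out x : x \in D -> demanded x -> exists2 x', nonedge x x' & x' \notin D.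
  move=> xD /demandedP[x' xx']; exists x' => //.
  by apply: contraTN xx' => x'D; apply: cD.
rewrite /F; case: pickP => [u /andP[uD du]|/(_ z)]; last by rewrite zD dz.
rewrite !inE; have [zu|zu] := eqVneq z u; have [wu|wu] := eqVneq w u => //.
  by move: zw; rewrite zu wu adj_irr.
exfalso; have adjD x y : x \in D -> y \in D -> x != y -> x -- y.
  move=> xD yD xy; case: (blk_cases xy0 xD yD) => // [E|n].
    by rewrite E eqxx in xy.
  by move: (cD x y xD yD); rewrite n.
have [u' uu' u'D] := out u uD du; have [z' zz' z'D] := out z zD dz.
have [w' ww' w'D] := out w wD dw.
have [uz uw] : u != z /\ u != w by rewrite !(eq_sym u).
by apply: (no_triangle pbG freeG (adjD u z _ _ _) zw (adjD u w _ _ _) uu' _ zz' _ ww');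
  rewrite // outside_blk.
Qed.

Section Cliques.
Variables P Q : {set G}.
Hypothesis PD : P \subset D.
Hypothesis cP : {in P &, forall z w, z = w \/ nonedge z w}.
Hypothesis cQ : {in Q &, forall z w, z = w \/ nonedge z w}.
Hypothesis cov : {in D &, forall z w, nonedge z w ->
  (z \in P /\ w \in P) \/ (z \in Q /\ w \in Q)}.
Hypothesis leQP : #|Q| <= #|P|.
Hypothesis P2 : 1 < #|P|.

Let inPD z : z \in P -> z \in D. Proof. exact: subsetP. Qed.

(** This is why the larger clique is called [P]. *)
Let not_in z : z \in Q -> z \notin P -> exists2 p, p \in P & p \notin Q.
Proof.
move=> zQ zP; apply/subsetPn; apply: contra zP => sPQ.
by have /eqP-> : P == Q by rewrite eqEcard sPQ leQP.
Qed.

Let cliqueP z w : z \in P -> w \in P -> z != w -> nonedge z w.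
Proof. by move=> zP wP zw; case: (cP zP wP) => // E; rewrite E eqxx in zw. Qed.

Let cliqueQ z w : z \in Q -> w \in Q -> z != w -> nonedge z w.
Proof. by move=> zP wP zw; case: (cQ zP wP) => // E; rewrite E eqxx in zw. Qed.

Let cross z w : z \in D -> w \in D -> z != w -> (z \notin P) || (w \notin P) ->
  (z \notin Q) || (w \notin Q) -> z -- w.
Proof.
move=> zD wD zw; case: (blk_cases xy0 zD wD) => // [E|n].
  by rewrite E eqxx in zw.
by case: (cov zD wD n) => - [-> ->].
Qed.

(** Otherwise [z] and [w] lie in [Q], and a vertex [p] of [P] outside [Q] is adjacent to [w]; the
    nonedges [zp] and [zw] make [z] doubly demanded. *)
Let same_sign z w : nonedge z w -> ~~ doubly_demanded z -> z \in P -> w \in D ->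
  w \in P.
Proof.
move=> zw dz zP wD; apply/negPn/negP=> wP.
have [zQ wQ] : z \in Q /\ w \in Q.
  by case: (cov (inPD zP) wD zw) => // - [_]; rewrite (negPf wP).
have [p pP pQ] := not_in wQ wP; case/negP: dz; apply/doubly_demandedP.
exists p, w; split=> //.
  by apply: cliqueP => //; apply: contraNneq pQ => <-.
apply: cross; rewrite ?wP ?pQ ?orbT //; first exact: inPD.
by apply: contraNneq pQ => ->.
Qed.

(** If both avoid [P], then [w], lying in neither clique, is adjacent to all of [D] and is demanded
    from outside. The position of [z] relative to [P] and [Q] decides which obstruction arises. *)
Let opposite_sign z w : z \in D -> w \in D -> z -- w -> demanded z -> demanded w ->
  w \notin Q -> (z \in P) || (w \in P).
Proof.
move=> zD wD zw dz dw wQ; apply/negPn; rewrite negb_or; apply/negP=> /andP[zP wP].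
have wz : w -- z by rewrite adj_sym.
have univ x : x \in D -> x \notin P -> x \notin Q -> demanded x ->
    exists2 x', nonedge x x' & x' \notin D.
  move=> xD xP xQ /demandedP[x' xx']; exists x' => //; apply/negP=> x'D.
  by case: (cov xD x'D xx') => - []; rewrite ?(negPf xP) ?(negPf xQ).
have [w' ww' w'D] := univ w wD wP wQ dw.
have wall x : x \in D -> x != w -> w -- x.
  by move=> xD xw; apply: cross; rewrite ?wP ?wQ // eq_sym.
have notP x y : x \notin P -> y \in P -> y != x.
  by move=> xP; apply: contraTneq => ->.
have [x1 [x2 [x1P x2P x12]]] : exists x1 x2, [/\ x1 \in P, x2 \in P & x1 != x2].
  by case/card_gt1P: P2 => x1 [x2 [? ? ?]]; exists x1, x2.
have n12 := cliqueP x1P x2P x12.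
have [/forall_inP zall|/forall_inPn[c cP' zc]] := boolP [forall p in P, z -- p].
  (* If [z] has no nonedge in [D], it is demanded from outside too, and the diamond [z], [w], [x1],
     [x2] is the middle of one of [G10] to [G12]. *)
  have [/exists_inP[d dD zd]|nd] := boolP [exists d in D, nonedge z d]; last first.
    have [z' zz'] := demandedP _ dz.
    have z'D : z' \notin D.
      by apply: contra nd => z'D; apply/exists_inP; exists z'.
    by apply: (no_diamond_chain pbG freeG zw (zall _ x1P) (zall _ x2P)
      (wall _ _ _) (wall _ _ _) x12 (nonedge_adj n12) zz' _ ww' _);
      (exact: inPD || exact: notP || apply: outside_blk; rewrite // adj_neq).
  (* With a nonedge [zd], the cycle [x1 z x2 d] is the rim of a [W4] with hub [w]: [G3] or [G4]. *)
  have [zQ dQ] : z \in Q /\ d \in Q.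
    by case: (cov zD dD zd) => // - [E]; rewrite E in zP.
  have PQ x : x \in P -> x \notin Q.
    move=> xP; apply/negP=> xQ; have := zall x xP; apply/negP/nonedge_adj.
    by apply: cliqueQ => //; rewrite eq_sym notP.
  have dP : d \notin P by apply: contraL dQ; apply: PQ.
  have dall x : x \in P -> d -- x.
    move=> xP; apply: cross; rewrite ?dP ?(PQ x xP) ?orbT //; first exact: inPD.
    by rewrite eq_sym notP.
  have dw' : d != w by apply: contraTneq dQ => ->.
  have z1 : x1 -- z by rewrite adj_sym zall.
  have d2 : x2 -- d by rewrite adj_sym dall.
  apply: (no_far_W4 pbG freeG z1 (zall _ x2P) d2 (dall _ x1P) x12 (nonedge_adj n12)
    (nonedge_neq zd) (nonedge_adj zd) (wall _ _ _) wz (wall _ _ _) (wall _ _ _) ww');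
    (exact: inPD || exact: notP || idtac) => //.
  by apply: outside_blk => //; [exact: inPD | rewrite eq_sym notP].
(* Here [c] lies in both cliques, and its nonedges to [z] and to some [p] in [P] outside [Q] give an
   F_1 with [w] of degree 4: [G1] or [G2]. *)
have zc' : nonedge z c.
  case: (blk_cases xy0 zD (inPD cP')) => // E; last by rewrite E in zc.
  by rewrite -E (negPf zP) in cP'.
have [zQ cQ'] : z \in Q /\ c \in Q.
  by case: (cov zD (inPD cP') zc') => // - [E]; rewrite E in zP.
have [p pP pQ] := not_in zQ zP.
have cp : nonedge c p by apply: cliqueP => //; apply: contraNneq pQ => <-.
have cz : nonedge c z by rewrite nonedgeC.
have pz : p -- z.
  by apply: cross; rewrite ?pQ ?zP ?orbT //; [exact: inPD | exact: notP].
have [wc wp] : w -- c /\ w -- p by split; apply: wall; (exact: inPD || exact: notP).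
have [f [fE fw fc _ _]] := F1_of_nonedges P4 P3K2 cp cz pz wc wp.
apply: (no_far_F1 pbG freeG fE fw ww'); rewrite fc.
by apply: outside_blk => //; [exact: inPD | rewrite eq_sym notP].
Qed.

(** Adjacent vertices cannot both lie in [P], nor both in [Q]; so one of them avoids [Q], and
    [opposite_sign] puts one of the two in [P]. *)
Lemma clique_signs : good_signs D P.
Proof.
apply/forall_inP=> z zD; apply/forall_inP=> w wD; apply/andP; split; apply/implyP.
  move=> /andP[/andP[zw dz] dw]; have wz : nonedge w z by rewrite nonedgeC.
  by apply/eqP; apply/idP/idP => ?; [apply: (same_sign zw) | apply: (same_sign wz)].
move=> /andP[/andP[zw dz] dw]; have wz : w -- z by rewrite adj_sym.
have zwN : ~~ ((z \in P) && (w \in P)).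
  apply/negP=> /andP[zP wP]; have := cliqueP zP wP (adj_neq zw).
  by move/nonedge_adj; rewrite zw.
have : (z \in P) || (w \in P).
  have [wQ|wQ] := boolP (w \in Q); last exact: opposite_sign.
  rewrite orbC; apply: opposite_sign => //; apply/negP=> zQ.
  by have := cliqueQ zQ wQ (adj_neq zw) => /nonedge_adj; rewrite zw.
by move: zwN; do 2!case: (_ \in P).
Qed.

End Cliques.

Lemma blk_signs : exists F, good_signs D F.
Proof.
have [P [Q [PD QD cP cQ cov]]] := two_cliques pbG xy0.
have [/exists_inP[z zD /exists_inP[w wD zw]]|nn] :=
  boolP [exists z in D, exists w in D, nonedge z w]; last first.
  apply: complete_blk_signs => z w zD wD; apply: contra nn => zw.
  by apply/exists_inP; exists z => //; apply/exists_inP; exists w.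
have two (N : {set G}) : z \in N -> w \in N -> 1 < #|N|.
  by move=> zN wN; apply/card_gt1P; exists z, w; rewrite nonedge_neq.
have zwPQ := cov z w zD wD zw.
have [le|/ltnW le] := leqP #|Q| #|P|.
  exists P; apply: (@clique_signs P Q) => //.
  by case: zwPQ => - [zN wN]; have := two _ zN wN => // /leq_trans; apply.
exists Q; apply: (@clique_signs Q P) => //.
  by move=> u v uD vD uv; case: (cov u v uD vD uv); auto.
by case: zwPQ => - [zN wN]; have := two _ zN wN => // /leq_trans; apply.
Qed.

End Block.

Lemma probe_labelling_exists : exists N1 N2 : {set G}, probe_labelling N1 N2.
Proof.
(* [F] depends only on the vertex set, so all pairs in a block see the same signs; by [blk_signs]
   the default is not reached on blocks. *)
pose F (D : {set G}) := odflt set0 [pick F | good_signs D F].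
pose e x y := (x \in F (blk x y)) (+) (y \in F (blk x y)).
have blkC x y : blk x y = blk y x by apply/setP=> z; rewrite !inE andbC.
have FP x y : insep x y -> good_signs (blk x y) (F (blk x y)).
  move=> xy; rewrite /F; case: pickP => //= N.
  by have [S] := blk_signs xy; rewrite N.
have eC x y : e x y = e y x by rewrite /e blkC addbC.
have eT x y z : insep x y -> insep y z -> insep x z -> e x z = e x y (+) e y z.
  move=> xy yz xz; have zD : z \in blk x y.
    by apply: mem_blk; rewrite insepC.
  have xD := blk_l xy; have yD := blk_r xy.
  rewrite /e (blk_eq xy xD zD (insep_neq xz)) (blk_eq xy yD zD (insep_neq yz)).
  by rewrite addbA; congr (_ (+) _); rewrite -addbA addbb addbF.
have [l Hl] := insep_potential eC eT.
have key x y : insep x y ->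
    (nonedge x y && ~~ doubly_demanded x && ~~ doubly_demanded y ==> (l x == l y)) &&
    (x -- y && demanded x && demanded y ==> (l x != l y)).
  move=> xy; move/forall_inP: (FP x y xy) => /(_ x (blk_l xy)).
  move=> /forall_inP /(_ y (blk_r xy)); have := Hl x y xy; rewrite /e.
  by do 2!case: (_ \in _); case: (l x); case: (l y).
(* The sign chooses the label of a demanded vertex, and a doubly demanded one enters both sets. *)
exists [set x | demanded x && (l x || doubly_demanded x)].
exists [set x | demanded x && (~~ l x || doubly_demanded x)].
have adj_l x y : x -- y -> demanded x -> demanded y ->
    [/\ l x != l y, ~~ doubly_demanded x & ~~ doubly_demanded y].
  move=> xy dx dy; have := key x y (adj_insep xy); rewrite xy dx dy.
  case/andP=> _ /= ->; split=> //.
    by apply: contraL dy; apply: (doubly_demanded_adj pbG freeG xy).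
  rewrite adj_sym in xy.
  by apply: contraL dx; apply: (doubly_demanded_adj pbG freeG xy).
split.
- move=> x y; rewrite !inE => /andP[dx lx] /andP[dy ly]; apply/negP=> xy.
  have [] := adj_l x y xy dx dy; move: lx ly.
  by do 2!case: (l _) => //=; do 2!case: (doubly_demanded _).
- move=> x y; rewrite !inE => /andP[dx lx] /andP[dy ly]; apply/negP=> xy.
  have [] := adj_l x y xy dx dy; move: lx ly.
  by do 2!case: (l _) => //=; do 2!case: (doubly_demanded _).
move=> x y xy; have yx : nonedge y x by rewrite nonedgeC.
have dx : demanded x by apply/demandedP; exists y.
have dy : demanded y by apply/demandedP; exists x.
have := key x y (nonedge_insep xy); rewrite !inE dx dy xy (negPf (nonedge_adj xy)).
case: (doubly_demanded x); case: (doubly_demanded y); case: (l x); case: (l y) => //=;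
  by auto.
Qed.

End Signs.

Lemma free_cat (s1 s2 : seq sgraph) (G : sgraph) :
  free (s1 ++ s2) G <-> free s1 G /\ free s2 G.
Proof.
elim: s1 => [|K s IH]; first by split=> [f|[]//]; split=> // H A [].
split=> [f|[f1 f2]].
  have [f1 f2] := iffLR IH (fun H A Hs => f H A (or_intror Hs)).
  by split=> // H A [E|Hs]; [apply: f; left | apply: f1].
by move=> H A [E|Hs]; [apply: f1; left | apply: (iffRL IH) Hs; split=> // L B LB;
  apply: f1; right].
Qed.

Theorem theorem6 (G : sgraph) :
  (two_probe_block_graph G <->
     distance_hereditary G /\ free (B_list ++ G_list) G) /\
  (two_probe_block_graph G <->
     free G_list G /\
     forall B : subgraph G, block B -> two_probe_complete_graph B).
Proof.
have sufficient : probe_blocks G -> free G_list G -> two_probe_block_graph G.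
  by move=> pbG fG; apply/two_probe_block_graphP/probe_labelling_exists.
split; split.
- case/two_probe_block_graphP=> N1 [N2 lab].
  have pbG := probe_labelling_probe_blocks lab.
  split; first exact: no_P4_distance_hereditary (pb_P4 pbG).
  by apply/free_cat; split;
    [exact: probe_blocks_B_free pbG | exact: probe_labelling_G_free lab].
- case=> dh /free_cat[fB fG]; apply: sufficient => //.
  exact: dh_probe_blocks dh fB.
- case/two_probe_block_graphP=> N1 [N2 lab]; split.
    exact: probe_labelling_G_free lab.
  exact: probe_labelling_blocks lab.
case=> fG tB; apply: sufficient => //.
exact: blocks_probe_complete_probe_blocks tB.
Qed.
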